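(* The unimodal spi-logic $\mathsf{SPi}_{lin}=\mathsf{SPi}+\{p\to\Diamond p,\ \Diamond\Diamond p\to\Diamond p,\ \Diamond(p\wedge q)\wedge\Diamond(p\wedge r)\to\Diamond(p\wedge\Diamond q\wedge\Diamond r)\}$ is decidable in polynomial time.
   Context: Unimodal setting: one diamond $\Diamond$. Sp-formulas: built from propositional variables and $\top$ by $\wedge$ and $\Diamond$; sp-implications $\sigma\to\tau$. A SLO is an algebra $(A,\wedge,\top,\Diamond)$ with $(A,\wedge,\top)$ a meet-semilattice with top and $\Diamond$ monotone; it validates $\sigma\to\tau$ if $\sigma[\mathfrak a]\le\tau[\mathfrak a]$ for all valuations. $\mathsf{SPi}+\Sigma$ is the set of sp-implications valid in every SLO validating $\Sigma$; decidability refers to deciding membership of a given sp-implication. *)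

(* Defs.v *)
From mathcomp Require Import all_boot.
From Stdlib Require Import BinNat BinPos.
Set Implicit Arguments. Unset Strict Implicit. Unset Printing Implicit Defensive.

Inductive spf : Type :=
| Var (n : nat)
| Top
| And (a b : spf)
| Dia (a : spf).

Record spi : Type := Imp { ante : spf; cons : spf }.

Record SLO : Type := {
  car : Type;
  meet : car -> car -> car;
  top : car;
  dia : car -> car;
  meetA : forall x y z, meet x (meet y z) = meet (meet x y) z;
  meetC : forall x y, meet x y = meet y x;
  meetxx : forall x, meet x x = x;
  meetxT : forall x, meet x top = x;
  (* monotonicity w.r.t. the semilattice order x <= y :<-> meet x y = x *)
  dia_mono : forall x y, meet x y = x -> meet (dia x) (dia y) = dia x
}.

Definition sle (A : SLO) (x y : car A) : Prop := meet x y = x.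

Fixpoint eval (A : SLO) (v : nat -> car A) (f : spf) : car A :=
  match f with
  | Var n => v n
  | Top => top A
  | And a b => meet (eval v a) (eval v b)
  | Dia a => dia (eval v a)
  end.

Definition valid (A : SLO) (i : spi) : Prop :=
  forall v : nat -> car A, sle (eval v (ante i)) (eval v (cons i)).

Definition SPi_plus (Sigma : spi -> Prop) (i : spi) : Prop :=
  forall A : SLO, (forall s, Sigma s -> valid A s) -> valid A i.

Definition p := Var 0.
Definition q := Var 1.
Definition r := Var 2.

Definition Sigma_lin (s : spi) : Prop :=
  s = Imp p (Dia p) \/
  s = Imp (Dia (Dia p)) (Dia p) \/
  s = Imp (And (Dia (And p q)) (Dia (And p r)))
          (Dia (And p (And (Dia q) (Dia r)))).

Definition SPi_lin : spi -> Prop := SPi_plus Sigma_lin.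

Inductive tok : Type := TVar | TB0 | TB1 | TEnd | TTop | TAnd | TDia | TImp.

Fixpoint pos_bits (x : positive) : seq tok :=
  match x with
  | xH => [:: TB1]
  | xO y => TB0 :: pos_bits y
  | xI y => TB1 :: pos_bits y
  end.

Definition nat_bits (n : nat) : seq tok :=
  match N.of_nat n with N0 => [::] | Npos x => pos_bits x end.

Fixpoint enc_f (f : spf) : seq tok :=
  match f with
  | Var n => TVar :: nat_bits n ++ [:: TEnd]
  | Top => [:: TTop]
  | And a b => TAnd :: enc_f a ++ enc_f b
  | Dia a => TDia :: enc_f a
  end.

Definition enc (i : spi) : seq tok := TImp :: enc_f (ante i) ++ enc_f (cons i).

Inductive move : Type := MoveL | MoveR | Stay.

Record TM : Type := {
  state : finType;
  gamma : finType;
  blank : gamma;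
  inp : tok -> gamma;
  q0 : state;
  halting : pred state;
  accepting : pred state;
  delta : state -> gamma -> state * gamma * move
}.

(* configuration: state, left part of tape (reversed), scanned symbol, right part *)
Definition config (M : TM) : Type :=
  (state M * seq (gamma M) * gamma M * seq (gamma M))%type.

Definition cstate (M : TM) (c : config M) : state M :=
  let: (s, _, _, _) := c in s.

Definition step (M : TM) (c : config M) : config M :=
  let: (s, l, a, rr) := c in
  if halting s then c else
  let: (s', b, m) := delta s a in
  match m with
  | Stay => (s', l, b, rr)
  | MoveL => match l with
             | [::] => (s', [::], blank M, b :: rr)
             | x :: l' => (s', l', x, b :: rr)
             end
  | MoveR => match rr with
             | [::] => (s', b :: l, blank M, [::])
             | x :: r' => (s', b :: l, x, r')
             end
  end.

Definition init (M : TM) (w : seq tok) : config M :=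
  match map (inp M) w with
  | [::] => (q0 M, [::], blank M, [::])
  | a :: rr => (q0 M, [::], a, rr)
  end.

(* the configuration after t steps (halting states are absorbing) *)
Definition run (M : TM) (t : nat) (w : seq tok) : config M :=
  iter t (@step M) (init M w).

Definition poly_time_decidable (P : spi -> Prop) : Prop :=
  exists (M : TM) (c k : nat), forall i : spi,
    let fin := cstate (@run M (c * (size (enc i)).+1 ^ k) (enc i)) in
    halting fin /\ (accepting fin <-> P i).

(* Main.v *)
From HB Require Import structures.
Require Import Defs.
From mathcomp Require Import all_boot.
From mathcomp Require Import zify.
From Stdlib Require Import BinNat BinPos.
From Stdlib Require Import FunctionalExtensionality PropExtensionality ProofIrrelevance.
Set Implicit Arguments. Unset Strict Implicit. Unset Printing Implicit Defensive.

(** In the presence of the first two axioms, the third one says that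
    [Dia (v /\ a /\ b)] equals [Dia (v /\ a) /\ Dia (v /\ b)] for closed [a], [b]
    (those with [Dia a <= a]).  Hence a formula is the conjunction of its top-level
    variables and of the formulas [Dia (P1 /\ Dia (P2 /\ ...))] read off its
    branches, and [s -> t] is derivable iff the top-level variables of [t] occur in
    those of [s] and every branch [Q1 ... Qk] of [t] has a weakly increasing map
    [f] into a branch [P1 ... Pm] of [s] (its root included) with [Q_i] contained
    in [P_(f i)]; such a map is found greedily.  The converse direction uses an
    algebra whose elements are closed sets of such words.

    The criterion can be checked with boundedly many pointers into the input.  A
    Turing machine keeps the pointers as marks on the tape cells and performs each
    pointer operation in one sweep over the input; since all loops are bounded by
    the input length, the running time is polynomial. *)

(** * Branch words and the decision criterion *)

(** The third axiom leaves [Dia q] and [Dia r] where a distributive law would have [q] and [r]; it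
    becomes distributive on closed formulas, and a branch word is closed because it starts with a
    diamond. There is one branch per diamond, so only linearly many, and [p -> Dia p] lets one
    letter be matched several times, so the maps need only increase weakly. The root of the
    antecedent becomes a letter by passing to [Dia (ante i)]; on the tape, [TImp] at position 0
    plays this additional diamond. Two features of the input shape the algorithm. Polish notation
    does not mark where a subformula ends, so ends are located by comparing numbers of leaves and of
    conjunctions. Variable indices are in binary and may exceed every pointer value, so names are
    compared token by token. The machine model is a bare one-tape machine; hence a small expression
    language with a single loop form is compiled once and for all. That loop is double because the
    greedy pointer may have to cross the whole antecedent for one letter of the consequent. *)

Fixpoint vars (f : spf) : seq nat :=
  match f with
  | Var n => [:: n]
  | And a b => vars a ++ vars b
  | _ => [::]
  end.

Fixpoint paths (f : spf) : seq (seq (seq nat)) :=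
  match f with
  | And a b => paths a ++ paths b
  | Dia a => [:: vars a] :: [seq vars a :: w | w <- paths a]
  | _ => [::]
  end.

Definition sub_vars (P Q : seq nat) : bool := all [in Q] P.

Definition skip_to (u : seq (seq nat)) (Q : seq nat) : seq (seq nat) :=
  drop (find (sub_vars Q) u) u.

(** An empty result means that some letter found no place. As [skip_to] keeps the matching letter at
    the head, the next letter may be matched there again. *)
Definition emb (w u : seq (seq nat)) : bool := foldl skip_to u w != [::].

(** Using [Dia (ante i)] puts the root letter of the antecedent in front of each of its branches and
    adds the branch made of the root alone. *)
Definition lin_dec (i : spi) : bool :=
  sub_vars (vars (cons i)) (vars (ante i)) &&
  all (fun w => has (emb w) (paths (Dia (ante i)))) (paths (cons i)).

Lemma skip_to_cons (P : seq nat) u Q :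
  skip_to (P :: u) Q = if sub_vars Q P then P :: u else skip_to u Q.
Proof. by rewrite /skip_to /=; case: ifP. Qed.

Lemma emb_cons Q w u : emb (Q :: w) u = emb w (skip_to u Q).
Proof. by []. Qed.

Lemma emb_nil w : emb w [::] = false.
Proof. by elim: w => // Q w; rewrite emb_cons. Qed.

(** A greedy search that starts earlier is never behind one that starts later, so taking the first
    possible place costs no embedding. *)
Lemma emb_drop w u k : emb w (drop k u) -> emb w u.
Proof.
elim: w u k => [|Q w IH] u k.
  by rewrite /emb /=; case: u => //=; rewrite ?drop_nil.
elim: u k => [|P u IHu] [|k] //=.
rewrite !emb_cons skip_to_cons => /IHu; rewrite emb_cons; case: ifP => // _ e.
apply: (IH _ 1) => /=; rewrite drop0.
exact: IH e.
Qed.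

Lemma emb_head w (P P' : seq nat) u :
  sub_vars P P' -> emb w (P :: u) -> emb w (P' :: u).
Proof.
move=> sPP'; elim: w => // Q w IH; rewrite !emb_cons !skip_to_cons.
case: ifP => [sQP|_].
  suff -> : sub_vars Q P' by [].
  by apply/allP=> x /(allP sQP) /= /(allP sPP').
case: ifP => // _ e; apply: (emb_drop (k := 1)); rewrite /= drop0.
exact: emb_drop e.
Qed.

(** * Soundness of the criterion in an arbitrary algebra of the variety *)

Section Soundness.
Variable A : SLO.
Implicit Types x y z : car A.

Lemma sle_refl x : sle x x. Proof. exact: meetxx. Qed.

Lemma sle_trans y x z : sle x y -> sle y z -> sle x z.
Proof. by rewrite /sle => xy yz; rewrite -{1}xy -meetA yz xy. Qed.

Lemma sle_meetl x y : sle (meet x y) x.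
Proof. by rewrite /sle meetC meetA meetxx. Qed.

Lemma sle_meetr x y : sle (meet x y) y.
Proof. by rewrite /sle -meetA meetxx. Qed.

Lemma sle_meet x y z : sle x y -> sle x z -> sle x (meet y z).
Proof. by rewrite /sle meetA => -> ->. Qed.

Lemma sle_top x : sle x (top A).
Proof. exact: meetxT. Qed.

Hypothesis linA : forall s, Sigma_lin s -> valid A s.

Lemma dia_refl x : sle x (dia x).
Proof.
have h : Sigma_lin (Imp p (Dia p)) by left.
exact: (linA h (fun _ => x)).
Qed.

Lemma dia_trans x : sle (dia (dia x)) (dia x).
Proof.
have h : Sigma_lin (Imp (Dia (Dia p)) (Dia p)) by right; left.
exact: (linA h (fun _ => x)).
Qed.

Lemma dia_lin x y z :
  sle (meet (dia (meet x y)) (dia (meet x z)))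
      (dia (meet x (meet (dia y) (dia z)))).
Proof.
have h : Sigma_lin (Imp (And (Dia (And p q)) (Dia (And p r)))
          (Dia (And p (And (Dia q) (Dia r))))) by right; right.
exact: (linA h (nth x [:: x; y; z])).
Qed.

Definition closed x := sle (dia x) x.

Lemma closed_dia x : closed (dia x). Proof. exact: dia_trans. Qed.

Lemma closed_top : closed (top A). Proof. exact: sle_top. Qed.

Lemma closed_meet x y : closed x -> closed y -> closed (meet x y).
Proof.
move=> cx cy; apply: sle_meet; [apply: sle_trans cx|apply: sle_trans cy];
  apply: dia_mono; [exact: sle_meetl | exact: sle_meetr].
Qed.

(** The axiom yields [dia y] and [dia z] under the diamond; closedness strips these inner diamonds.
    The opposite inequality is plain monotonicity. *)
Lemma dia_meet_closed x y z : closed y -> closed z ->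
  sle (meet (dia (meet x y)) (dia (meet x z))) (dia (meet x (meet y z))).
Proof.
move=> cy cz; apply: sle_trans (dia_lin x y z) _; apply: dia_mono.
apply: sle_meet; first exact: sle_meetl.
apply: sle_trans (sle_meetr _ _) _; apply: sle_meet.
  by apply: sle_trans (sle_meetl _ _) _.
by apply: sle_trans (sle_meetr _ _) _.
Qed.

Variable v : nat -> car A.

Definition vmeet (P : seq nat) : car A := foldr (fun n x => meet (v n) x) (top A) P.

Definition wdia (w : seq (seq nat)) : car A :=
  foldr (fun P x => dia (meet (vmeet P) x)) (top A) w.

Definition wmeet (L : seq (seq (seq nat))) : car A :=
  foldr (fun w x => meet (wdia w) x) (top A) L.

Lemma sle_vmeet x P : (forall n, n \in P -> sle x (v n)) -> sle x (vmeet P).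
Proof.
elim: P => [|n P IH] h /=; first exact: sle_top.
apply: sle_meet; first by apply: h; rewrite mem_head.
by apply: IH => m mP; apply: h; rewrite inE mP orbT.
Qed.

Lemma vmeet_sle P n : n \in P -> sle (vmeet P) (v n).
Proof.
elim: P => // m P IH; rewrite inE => /predU1P [->|/IH h] /=; first exact: sle_meetl.
exact: sle_trans (sle_meetr _ _) h.
Qed.

Lemma vmeet_sub P Q : sub_vars P Q -> sle (vmeet Q) (vmeet P).
Proof. by move=> /allP s; apply: sle_vmeet => n /s /= /vmeet_sle. Qed.

Lemma sle_wmeet x L : (forall w, w \in L -> sle x (wdia w)) -> sle x (wmeet L).
Proof.
elim: L => [|w L IH] h /=; first exact: sle_top.
apply: sle_meet; first by apply: h; rewrite mem_head.
by apply: IH => m mP; apply: h; rewrite inE mP orbT.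
Qed.

Lemma wmeet_sle L w : w \in L -> sle (wmeet L) (wdia w).
Proof.
elim: L => // m L IH; rewrite inE => /predU1P [->|/IH h] /=; first exact: sle_meetl.
exact: sle_trans (sle_meetr _ _) h.
Qed.

Lemma closed_wdia w : closed (wdia w).
Proof. by case: w => [|P w]; [exact: closed_top | exact: closed_dia]. Qed.

Lemma closed_wmeet L : closed (wmeet L).
Proof.
elim: L => [|w L IH]; first exact: closed_top.
by apply: closed_meet => //; exact: closed_wdia.
Qed.

Lemma wdia_cons P w : sle (wdia (P :: w)) (wdia w).
Proof.
apply: sle_trans (closed_wdia w); apply: dia_mono; exact: sle_meetr.
Qed.

Lemma wdia_drop k w : sle (wdia w) (wdia (drop k w)).
Proof.
elim: w k => [|P w IH] [|k] //; try exact: sle_refl.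
exact: sle_trans (wdia_cons P w) (IH k).
Qed.

Lemma wdia_emb w u : emb w u -> sle (wdia u) (wdia w).
Proof.
elim: w u => [|Q w IH] u; first by move=> _; exact: sle_top.
rewrite emb_cons => e; apply: sle_trans (wdia_drop (find (sub_vars Q) u) u) _.
case: (boolP (has (sub_vars Q) u)) => [h|h]; last first.
  by move: e; rewrite /skip_to hasNfind // drop_size emb_nil.
have hQ := nth_find [::] h; move: h; rewrite has_find => h.
move: e; rewrite /skip_to (drop_nth [::] h).
move: (nth _ _ _) (drop _.+1 _) hQ => P u' sQP /IH e /=.
apply: dia_mono; apply: sle_meet.
  by apply: sle_trans (sle_meetl _ _) (vmeet_sub sQP).
(* The rest [w] is embedded in [P :: u'] and not in [u'], since [P] may be reused; reflexivity
   supplies the outer diamond of [P :: u']. *)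
by apply: sle_trans e => /=; exact: dia_refl.
Qed.

(** This iterates [dia_meet_closed]. The leading [dia x] corresponds to the branch that stops at
    this diamond, and it settles the empty conjunction. *)
Lemma dia_wmeet x (L : seq (seq (seq nat))) :
  sle (meet (dia x) (foldr (fun w y => meet (dia (meet x (wdia w))) y) (top A) L))
      (dia (meet x (wmeet L))).
Proof.
elim: L => [|w L IH] /=; first by rewrite !meetxT; exact: sle_refl.
apply: (sle_trans _ (dia_meet_closed x (closed_wdia w) (closed_wmeet L))).
apply: sle_meet.
  exact: sle_trans (sle_meetr _ _) (sle_meetl _ _).
apply: sle_trans IH; apply: sle_meet; first exact: sle_meetl.
exact: sle_trans (sle_meetr _ _) (sle_meetr _ _).
Qed.

Lemma wmeet_paths_dia f :
  wmeet (paths (Dia f)) =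
  meet (dia (vmeet (vars f)))
    (foldr (fun w y => meet (dia (meet (vmeet (vars f)) (wdia w))) y) (top A) (paths f)).
Proof. by rewrite /wmeet /= foldr_map /= meetxT. Qed.

Lemma eval_vars f : sle (eval v f) (vmeet (vars f)).
Proof.
apply: sle_vmeet; elim: f => [m|//|a IHa b IHb|//] n /=.
  by rewrite inE => /eqP ->; exact: sle_refl.
rewrite mem_cat => /orP [/IHa|/IHb]; apply: sle_trans.
  exact: sle_meetl.
exact: sle_meetr.
Qed.

Lemma eval_paths f : sle (eval v f) (wmeet (paths f)).
Proof.
apply: sle_wmeet; elim: f => [m|//|a IHa b IHb|a IHa] w //=.
  rewrite mem_cat => /orP [/IHa|/IHb]; apply: sle_trans.
    exact: sle_meetl.
  exact: sle_meetr.
rewrite inE => /predU1P [->|/mapP [u uin ->]] /=; apply: dia_mono.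
  by rewrite meetxT; exact: eval_vars.
by apply: sle_meet (IHa _ uin); exact: eval_vars.
Qed.

(** The converse bounds [eval_vars] and [eval_paths] use at most monotonicity; here the diamond case
    needs the third axiom, to glue the branches below a diamond together again. *)
Lemma sle_eval f : sle (meet (vmeet (vars f)) (wmeet (paths f))) (eval v f).
Proof.
elim: f => [m||a IHa b IHb|a IHa] /=.
- by rewrite !meetxT; exact: sle_refl.
- exact: sle_top.
- apply: sle_meet; [apply: sle_trans IHa|apply: sle_trans IHb]; apply: sle_meet.
  + apply: sle_trans (sle_meetl _ _) _; apply: vmeet_sub.
    by apply/allP => n ni; rewrite /= mem_cat ni.
  + apply: sle_trans (sle_meetr _ _) _; apply: sle_wmeet => w wi.
    by apply: wmeet_sle; rewrite mem_cat wi.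
  + apply: sle_trans (sle_meetl _ _) _; apply: vmeet_sub.
    by apply/allP => n ni; rewrite /= mem_cat ni orbT.
  + apply: sle_trans (sle_meetr _ _) _; apply: sle_wmeet => w wi.
    by apply: wmeet_sle; rewrite mem_cat wi orbT.
- apply: sle_trans (sle_meetr _ _) _; rewrite [X in sle X _]wmeet_paths_dia.
  apply: sle_trans (dia_wmeet _ _) _; exact: dia_mono.
Qed.

Lemma lin_dec_sle i : lin_dec i -> sle (eval v (ante i)) (eval v (cons i)).
Proof.
case: i => s t; rewrite /lin_dec [ante _]/= [cons _]/= => /andP [sv /allP ap].
apply: sle_trans (sle_eval t); apply: sle_meet.
  exact: sle_trans (eval_vars s) (vmeet_sub sv).
apply: sle_wmeet => w /ap /hasP [u ui e].
(* Going up to [Dia s] makes the root of [s] available as the first letter of every branch. *)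
apply: sle_trans (dia_refl _) _.
apply: sle_trans (eval_paths (Dia s)) _.
apply: sle_trans (wmeet_sle ui) (wdia_emb e).
Qed.

End Soundness.

(** * Completeness: the algebra of closed word sets *)

(* An element [(V, U)] stands for the conjunction of the variables in [V] and of
   the diamond words in [U]. *)
Definition wset : Type := ((nat -> Prop) * (seq (seq nat) -> Prop))%type.

(** The rule [wcl_cons] reflects [p -> Dia p]: what lies below the variables of [Q] and below the
    word [w] lies below the diamond of their meet. *)
Inductive wcl (V : nat -> Prop) (U : seq (seq nat) -> Prop) : seq (seq nat) -> Prop :=
| wcl_in w : U w -> wcl V U w
| wcl_cons Q w : (forall n, n \in Q -> V n) -> wcl V U w -> wcl V U (Q :: w).

Definition wclosed (x : wset) : Prop :=
  x.2 [::] /\ forall Q w, (forall n, n \in Q -> x.1 n) -> x.2 w -> x.2 (Q :: w).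

Definition wcar : Type := {x : wset | wclosed x}.

Lemma wcar_ext (x y : wcar) :
  (forall n, (sval x).1 n <-> (sval y).1 n) ->
  (forall w, (sval x).2 w <-> (sval y).2 w) -> x = y.
Proof.
case: x y => [[V U] cx] [[V' U'] cy] /= hV hU.
have eV : V = V' by apply: functional_extensionality => n; exact: propositional_extensionality.
have eU : U = U' by apply: functional_extensionality => n; exact: propositional_extensionality.
by subst; rewrite (proof_irrelevance _ cx cy).
Qed.

Lemma wcl_min V U (x : wcar) w :
  (forall n, V n -> (sval x).1 n) -> (forall w, U w -> (sval x).2 w) ->
  wcl V U w -> (sval x).2 w.
Proof.
move=> hV hU; elim=> [u /hU //|Q u hQ _ IH].
by case: (svalP x) => _; apply=> // n /hQ /hV.
Qed.

Lemma wmeet_closed (x y : wcar) :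
  wclosed (fun n => (sval x).1 n \/ (sval y).1 n,
    wcl (fun n => (sval x).1 n \/ (sval y).1 n) (fun w => (sval x).2 w \/ (sval y).2 w)).
Proof.
split; first by apply: wcl_in; left; case: (svalP x).
by move=> Q w hQ h; apply: wcl_cons.
Qed.

Definition word_meet (x y : wcar) : wcar := exist _ _ (wmeet_closed x y).

Lemma wtop_closed (V : nat -> Prop) : wclosed (V, wcl V (fun w => w = [::])).
Proof. by split; [exact: wcl_in | move=> Q w; exact: wcl_cons]. Qed.

Definition word_top : wcar := exist _ _ (wtop_closed (fun _ => False)).

Definition word_var (n : nat) : wcar := exist _ _ (wtop_closed (fun m => m = n)).

Lemma wdia_closed (x : wcar) : wclosed (fun _ => False, (sval x).2).
Proof.
case: (svalP x) => h0 h; split=> // Q w hQ; apply: h => n /hQ; by [].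
Qed.

(** Only the current variables are forgotten. The words stay as they are because, by closure, they
    already include those starting with a letter over the current variables. *)
Definition word_dia (x : wcar) : wcar := exist _ _ (wdia_closed x).

Definition wle (x y : wcar) : Prop :=
  (forall n, (sval y).1 n -> (sval x).1 n) /\ (forall w, (sval y).2 w -> (sval x).2 w).

Lemma wle_refl x : wle x x. Proof. by split. Qed.

Lemma wle_trans y x z : wle x y -> wle y z -> wle x z.
Proof. by move=> [a b] [c d]; split=> [n /c /a|w /d /b]. Qed.

Lemma wle_antisym x y : wle x y -> wle y x -> x = y.
Proof. by move=> [a b] [c d]; apply: wcar_ext; split; auto. Qed.

Lemma wle_meetl x y : wle (word_meet x y) x.
Proof. by split=> [n|w] h /=; [left | apply: wcl_in; left]. Qed.

Lemma wle_meetr x y : wle (word_meet x y) y.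
Proof. by split=> [n|w] h /=; [right | apply: wcl_in; right]. Qed.

Lemma wle_meet x y z : wle x y -> wle x z -> wle x (word_meet y z).
Proof.
move=> [a b] [c d]; have hV n : (sval y).1 n \/ (sval z).1 n -> (sval x).1 n.
  by case; auto.
by split=> [|w] //=; apply: wcl_min => // u [/b|/d].
Qed.

Lemma wle_top x : wle x word_top.
Proof.
split=> [n []|w]; apply: wcl_min => [n []|u ->].
by case: (svalP x).
Qed.

Lemma word_meetP x y : word_meet x y = x <-> wle x y.
Proof.
split=> [<-|h]; first exact: wle_meetr.
apply: wle_antisym; first exact: wle_meetl.
by apply: wle_meet => //; exact: wle_refl.
Qed.

Lemma word_meetA x y z : word_meet x (word_meet y z) = word_meet (word_meet x y) z.
Proof.
apply: wle_antisym; repeat apply: wle_meet;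
  eauto using wle_refl, wle_trans, wle_meetl, wle_meetr.
Qed.

Lemma word_meetC x y : word_meet x y = word_meet y x.
Proof. by apply: wle_antisym; apply: wle_meet; auto using wle_meetl, wle_meetr. Qed.

Lemma word_dia_mono x y : word_meet x y = x ->
  word_meet (word_dia x) (word_dia y) = word_dia x.
Proof. by move=> /word_meetP [a b]; apply/word_meetP; split. Qed.

Definition wordSLO : SLO :=
  @Build_SLO wcar word_meet word_top word_dia word_meetA word_meetC
    (fun x => proj2 (word_meetP x x) (wle_refl x))
    (fun x => proj2 (word_meetP x word_top) (wle_top x)) word_dia_mono.

Lemma wordSLO_lin s : Sigma_lin s -> valid wordSLO s.
Proof.
case=> [->|[->|->]] v; apply/word_meetP.
- by split.
- by split.
split=> [n []|w] /= hw; apply: wcl_in.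
(* Every word grows from a single generator, taken from [v 0], [v 1] or [v 2], by prefixing letters
   over the variables of [v 0]; so it lies entirely in one of the two conjuncts on the left. *)
elim: hw => {w} [w [hw|]|Q w hQ _ IH].
- by left; apply: wcl_in; left.
- elim=> {w} [w [hw|hw]|Q w hQ hw IH].
  + by left; apply: wcl_in; right.
  + by right; apply: wcl_in; right.
  + by case: IH => IH; [left|right]; apply: wcl_cons => // n /hQ [].
- have {}hQ n : n \in Q -> (sval (v 0)).1 n by move/hQ => [|[]].
  by case: IH => IH; [left|right]; apply: wcl_cons => // n /hQ; left.
Qed.

Lemma word_eval_vars f n : (sval (eval (A := wordSLO) word_var f)).1 n <-> n \in vars f.
Proof.
elim: f => [m||a IHa b IHb|a _] //=.
  by rewrite inE; split=> [->|/eqP].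
by rewrite mem_cat IHa IHb; split=> /orP.
Qed.

Lemma word_eval_paths f w :
  w \in paths f -> (sval (eval (A := wordSLO) word_var f)).2 w.
Proof.
elim: f w => [m||a IHa b IHb|a IHa] w //=.
  by rewrite mem_cat => /orP [/IHa|/IHb] h; apply: wcl_in; [left|right].
have [h0 h1] := svalP (eval (A := wordSLO) word_var a).
have hV n : n \in vars a -> (sval (eval (A := wordSLO) word_var a)).1 n.
  by rewrite word_eval_vars.
rewrite inE => /predU1P [->|/mapP [u /IHa hu ->]]; exact: h1.
Qed.

Lemma mem_paths_dia f u : u \in paths (Dia f) -> exists u', u = vars f :: u'.
Proof. by rewrite inE => /predU1P [->|/mapP [u' _ ->]]; eexists. Qed.

(** All branches of [Dia f] begin with [vars f], so [Q] is matched at the root without moving the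
    search. *)
Lemma paths_dia_emb_cons f w Q : sub_vars Q (vars f) ->
  has (emb w) (paths (Dia f)) -> has (emb (Q :: w)) (paths (Dia f)).
Proof.
move=> sQ /hasP [u ui e]; apply/hasP; exists u => //.
have [u' eu] := mem_paths_dia ui.
by rewrite emb_cons eu skip_to_cons sQ -eu.
Qed.

(** Each operation keeps words embeddable: a meet enlarges the root letter of a branch ([emb_head]),
    prefixing reuses the root letter, and a diamond puts an empty root letter in front
    ([emb_drop]). *)
Lemma word_eval_emb f w :
  (sval (eval (A := wordSLO) word_var f)).2 w -> has (emb w) (paths (Dia f)).
Proof.
elim: f w => [m||a IHa b IHb|a IHa] w.
- elim=> {}w; first by move=> ->.
  move=> u hQ _ IH; apply: paths_dia_emb_cons => //.
  by apply/allP => n /hQ /= ->; rewrite mem_head.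
- elim=> {}w; first by move=> ->.
  move=> u hQ _ IH; apply: paths_dia_emb_cons => //.
  by apply/allP => n /hQ.
- elim=> {w} [w|Q w hQ _ IH]; last first.
    apply: paths_dia_emb_cons => //; apply/allP => n /hQ /=.
    by rewrite !word_eval_vars mem_cat => /orP.
  have up c L : sub_vars (vars c) (vars a ++ vars b) -> {subset paths c <= L} ->
      has (emb w) (paths (Dia c)) ->
      has (emb w) ([:: vars a ++ vars b] :: [seq (vars a ++ vars b) :: u | u <- L]).
    move=> sc sL /hasP [u]; rewrite inE => /predU1P [->|/mapP [u' ui ->]] /(emb_head sc) e;
      apply/hasP; eexists; try exact: e.
      by rewrite mem_head.
    by rewrite inE map_f ?orbT // sL.
  case=> [/IHa|/IHb]; apply: up => [|u ui]; rewrite ?mem_cat ?ui ?orbT //;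
    by apply/allP => n ni; rewrite /= mem_cat ni ?orbT.
- move=> /IHa /hasP [u ui e]; apply/hasP; exists ([::] :: u).
    by rewrite inE map_f ?orbT.
  by apply: (emb_drop (k := 1)); rewrite /= drop0.
Qed.

Theorem SPi_linP i : SPi_lin i <-> lin_dec i.
Proof.
split=> [h|d A linA v]; last exact: lin_dec_sle.
have /word_meetP [hV hU] := h _ wordSLO_lin (word_var : nat -> car wordSLO).
apply/andP; split.
  by apply/allP => n /word_eval_vars /hV /word_eval_vars.
by apply/allP => w /word_eval_paths /hU /word_eval_emb.
Qed.

(** * Machines with two exits *)

Definition tok_ord (t : tok) : 'I_8 :=
  match t with
  | TVar => @Ordinal 8 0 isT | TB0 => @Ordinal 8 1 isT | TB1 => @Ordinal 8 2 isT | TEnd => @Ordinal 8 3 isT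
  | TTop => @Ordinal 8 4 isT | TAnd => @Ordinal 8 5 isT | TDia => @Ordinal 8 6 isT | TImp => @Ordinal 8 7 isT
  end.

Definition ord_tok (i : 'I_8) : tok :=
  nth TVar [:: TVar; TB0; TB1; TEnd; TTop; TAnd; TDia; TImp] i.

Lemma tok_ordK : cancel tok_ord ord_tok.
Proof. by case. Qed.

HB.instance Definition _ := Finite.copy tok (can_type tok_ordK).

Section Machines.
Variables (G : finType) (bl : G).

Definition tape : Type := (seq G * G * seq G)%type.

Definition mk_tape (l s : seq G) : tape :=
  if s is x :: s' then (l, x, s') else (l, bl, [::]).

Definition move_tape (m : move) (l : seq G) (b : G) (s : seq G) : tape :=
  match m with
  | Stay => (l, b, s)
  | MoveL => if l is x :: l' then (l', x, b :: s) else ([::], bl, b :: s)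
  | MoveR => mk_tape (b :: l) s
  end.

(* The two exits of a machine serve as the two outcomes of a test. *)
Record mach : Type := Mach {
  mst : finType;
  mstart : mst;
  mdelta : mst -> G -> (mst + bool) * G * move
}.

Definition mstep (M : mach) (c : (mst M + bool) * tape) : (mst M + bool) * tape :=
  match c with
  | (inr _, _) => c
  | (inl s, (l, a, s')) => let: (q, b, m) := mdelta s a in (q, move_tape m l b s')
  end.

Definition exec (M : mach) (tp : tape) (b : bool) (tp' : tape) (T : nat) : Prop :=
  exists2 t, t <= T & iter t (@mstep M) (inl (mstart M), tp) = (inr b, tp').

Lemma iter_mstep_inr M t b tp : iter t (@mstep M) (inr b, tp) = (inr b, tp).
Proof. by elim: t => //= t ->. Qed.

(** The common core of the machine combinators: [M] sits inside [N] along [g], and [h] says where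
    its exits are rerouted. *)
Lemma iter_simulation (M N : mach) (h : mst M + bool -> mst N + bool) (g : mst M -> mst N) :
  (forall s, h (inl s) = inl (g s)) ->
  (forall s a, mdelta (g s) a = let: (q, b, m) := mdelta s a in (h q, b, m)) ->
  forall t s tp b tp', iter t (@mstep M) (inl s, tp) = (inr b, tp') ->
  exists2 t', t' <= t & iter t' (@mstep N) (inl (g s), tp) = (h (inr b), tp').
Proof.
move=> hg hd; elim=> [|t IH] s [[l a] r] b tp' //; rewrite iterSr /=.
have := hd s a; case: (mdelta s a) => [[[s'|b'] c] m] e.
  move/IH => [t' le e']; exists t'.+1 => //; rewrite iterSr /= e hg //.
rewrite iter_mstep_inr => - [<- <-]; exists 1 => //=; by rewrite e.
Qed.

(** The last step of the test already enters the chosen branch, so running times add up without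
    overhead. *)
Definition ite_mach (M1 M2 M3 : mach) : mach :=
  @Mach (mst M1 + (mst M2 + mst M3))%type (inl (mstart M1))
    (fun s a =>
       match s with
       | inl s => let: (q, b, m) := mdelta s a in
           (match q with
            | inl s => inl (inl s)
            | inr b => inl (inr (if b then inl (mstart M2) else inr (mstart M3)))
            end, b, m)
       | inr (inl s) => let: (q, b, m) := mdelta s a in
           (match q with inl s => inl (inr (inl s)) | inr b => inr b end, b, m)
       | inr (inr s) => let: (q, b, m) := mdelta s a in
           (match q with inl s => inl (inr (inr s)) | inr b => inr b end, b, m)
       end).

Lemma exec_ite M1 M2 M3 tp b tp1 T1 b' tp2 T2 :
  exec M1 tp b tp1 T1 -> exec (if b then M2 else M3) tp1 b' tp2 T2 ->
  exec (ite_mach M1 M2 M3) tp b' tp2 (T1 + T2).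
Proof.
move=> [t1 le1 e1] [t2 le2 e2].
have [t1' le1' e1'] := @iter_simulation M1 (ite_mach M1 M2 M3)
  (fun q => match q with
            | inl s => inl (inl s)
            | inr b => inl (inr (if b then inl (mstart M2) else inr (mstart M3)))
            end) inl (fun _ => erefl) (fun _ _ => erefl) _ _ _ _ _ e1.
have [t2' le2' e2'] : exists2 t', t' <= t2 &
    iter t' (@mstep (ite_mach M1 M2 M3))
     (inl (inr (if b then inl (mstart M2) else inr (mstart M3))), tp1) = (inr b', tp2).
  case: b {e1 e1'} e2 => e2.
    exact: (@iter_simulation M2 (ite_mach M1 M2 M3)
      (fun q => match q with inl s => inl (inr (inl s)) | inr b => inr b end)
      (fun s => inr (inl s)) (fun _ => erefl) (fun _ _ => erefl) _ _ _ _ _ e2).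
  exact: (@iter_simulation M3 (ite_mach M1 M2 M3)
      (fun q => match q with inl s => inl (inr (inr s)) | inr b => inr b end)
      (fun s => inr (inr s)) (fun _ => erefl) (fun _ _ => erefl) _ _ _ _ _ e2).
exists (t2' + t1'); first by lia.
by rewrite iterD e1'.
Qed.

(** There is no separate loop condition: the body decides by its exit whether to go on, and a
    finished loop always leaves by [true]. *)
Definition loop_mach (M : mach) : mach :=
  @Mach (mst M) (mstart M)
    (fun s a => let: (q, b, m) := mdelta s a in
       (match q with
        | inl s => inl s
        | inr b => if b then inl (mstart M) else inr true
        end, b, m)).

Lemma loop_simulation M t tp b tp' :
  iter t (@mstep M) (inl (mstart M), tp) = (inr b, tp') ->
  exists2 t', t' <= t & iter t' (@mstep (loop_mach M)) (inl (mstart M), tp) =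
    (if b then inl (mstart M) else inr true, tp').
Proof.
exact: (@iter_simulation M (loop_mach M)
  (fun q => match q with
        | inl s => inl s
        | inr b => if b then inl (mstart M) else inr true
        end) id).
Qed.

Lemma exec_loop_exit M tp tp' T :
  exec M tp false tp' T -> exec (loop_mach M) tp true tp' T.
Proof.
by move=> [t le /loop_simulation [t' le' e]]; exists t' => //; exact: leq_trans le.
Qed.

Lemma exec_loop_step M tp tp1 T1 b tp2 T2 :
  exec M tp true tp1 T1 -> exec (loop_mach M) tp1 b tp2 T2 ->
  exec (loop_mach M) tp b tp2 (T1 + T2).
Proof.
move=> [t1 le1 /loop_simulation [t1' le1' e1]] [t2 le2 e2].
by exists (t2 + t1'); [lia | rewrite iterD e1].
Qed.

Definition const_mach (b : bool) : mach :=
  @Mach unit tt (fun _ a => (inr b, a, Stay)).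

Lemma exec_const b tp : exec (const_mach b) tp b tp 1.
Proof. by exists 1 => //; case: tp => [[]]. Qed.

End Machines.

(** * Machines that perform one sweep over the input *)

Section Sweep.
Variable (C : finType) (isfirst : pred C).
Variables (S : finType) (f : S -> C -> S * C) (s0 : S) (out : S -> bool).
Notation G := (option C).

(** A Mealy automaton runs rightwards over the nonblank cells; its final state is turned into an
    answer that is carried back to the left end. The tape has no end markers: the right end is the
    first blank, the left end the cell satisfying [isfirst]. *)
Definition sweep_mach : mach G :=
  @Mach G (S + bool)%type (inl s0)
    (fun q g => match q, g with
       | inl s, Some c => let: (s', c') := f s c in (inl (inl s'), Some c', MoveR)
       | inl s, None => (inl (inr (out s)), None, MoveL)
       | inr b, Some c => if isfirst c then (inr b, g, Stay) else (inl (inr b), g, MoveL)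
       | inr b, None => (inl (inr b), g, MoveL)
       end).

Fixpoint mealy (s : S) (cs : seq C) : S * seq C :=
  if cs is c :: cs' then
    let: (s', c') := f s c in let: (s2, cs2) := mealy s' cs' in (s2, c' :: cs2)
  else (s, [::]).

Let mkt := @mk_tape G None.

Lemma sweep_right s l cs m :
  iter (size cs) (@mstep G None sweep_mach)
    (inl (inl s), mkt l (map some cs ++ nseq m None)) =
  (inl (inl (mealy s cs).1),
    mkt (rev (map some (mealy s cs).2) ++ l) (nseq m None)).
Proof.
elim: cs s l => [//|c cs IH] s l; rewrite [size _]/= iterSr /=.
case E: (f s c) => [s' c'] /=; rewrite IH.
by case: (mealy s' cs) => s2 cs2 /=; rewrite rev_cons cat_rcons.
Qed.

Lemma sweep_left b (c0 : C) (ds : seq C) (l : seq G) x rest :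
  isfirst c0 -> all (predC isfirst) ds -> map some (rcons ds c0) = x :: l ->
  iter (size ds).+1 (@mstep G None sweep_mach) (inl (inr b), (l, x, rest)) =
  (inr b, mkt [::] (Some c0 :: rev (map some ds) ++ rest)).
Proof.
move=> f0; elim: ds x l rest => [|d ds IH] x l rest.
  by move=> _ [<- <-] /=; rewrite f0.
case/andP => nd ads [<- <-]; rewrite [size _]/= iterSr.
have -> : mstep None (M := sweep_mach) (inl (inr b), (map some (rcons ds c0), Some d, rest)) =
    (inl (inr b), move_tape None MoveL (map some (rcons ds c0)) (Some d) rest).
  by rewrite /= (negbTE nd).
case E: (map some (rcons ds c0)) => [|y l']; first by case: ds {IH ads} E.
by rewrite [move_tape _ _ _ _ _]/= (IH _ _ _ ads E) /= rev_cons cat_rcons.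
Qed.

Lemma exec_sweep cs c0 cs1 m s' :
  mealy s0 cs = (s', c0 :: cs1) -> isfirst c0 -> all (predC isfirst) cs1 ->
  exec None sweep_mach (mkt [::] (map some cs ++ nseq m None)) (out s')
    (mkt [::] (map some (c0 :: cs1) ++ nseq m.-1.+1 None)) (2 * size cs).+1.
Proof.
move=> e f0 a1.
have sz : size cs = (size cs1).+1.
  suff: size (mealy s0 cs).2 = size cs by rewrite e.
  elim: cs (s0) {e} => //= c cs IH s; case: (f s c) => s1 c1 /=.
  by rewrite -(IH s1); case: mealy.
(* These are [size cs] steps to the right, one to turn on the blank, [size cs1] steps back and one
   to exit. *)
exists ((size cs1).+1 + (1 + size cs)); first by lia.
case E: (map some (rcons (rev cs1) c0)) => [|y l']; first by case: (rev cs1) E.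
have -> : iter ((size cs1).+1 + (1 + size cs)) (@mstep G None sweep_mach)
    (inl (mstart sweep_mach), mkt [::] (map some cs ++ nseq m None)) =
  iter (size (rev cs1)).+1 (@mstep G None sweep_mach)
    (inl (inr (out s')), (l', y, None :: nseq m.-1 None)).
  rewrite size_rev iterD; congr iter.
  rewrite iterD sweep_right e /= rev_cons cats0 -map_rev -map_rcons E.
  by case: m.
rewrite (sweep_left _ _ f0 _ E) ?all_rev //.
by rewrite map_rev revK.
Qed.

End Sweep.

(** * Registers as marks on the input cells *)

Section Pebbles.
Variable K : nat.

Notation marks := {ffun 'I_K.+1 -> bool}.
Notation cell := (tok * marks)%type.

Definition mark (i : nat) (c : cell) : bool := c.2 (inord i).

Definition set_mark (i : nat) (b : bool) (c : cell) : cell :=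
  (c.1, [ffun k => if k == inord i then b else c.2 k]).

(* A register holding [rho i] is the mark [i] in cell [rho i]; the value
   [size w] leaves no mark at all. *)
Definition marks_at (rho : nat -> nat) (j : nat) : marks :=
  [ffun i : 'I_K.+1 => rho i == j].

Fixpoint cells (rho : nat -> nat) (j : nat) (w : seq tok) : seq cell :=
  if w is t :: w' then (t, marks_at rho j) :: cells rho j.+1 w' else [::].

Definition upd (rho : nat -> nat) (i v : nat) : nat -> nat :=
  fun k => if k == i then v else rho k.

Lemma mark_cell rho i t j : i <= K -> mark i (t, marks_at rho j) = (rho i == j).
Proof. by move=> le; rewrite /mark ffunE inordK. Qed.

Lemma set_mark_cell rho i t j v b : i <= K -> (v == j) = b ->
  set_mark i b (t, marks_at rho j) = (t, marks_at (upd rho i v) j).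
Proof.
move=> le e; congr pair; apply/ffunP => k; rewrite !ffunE /upd -val_eqE /= inordK //.
by case: ifP.
Qed.

Lemma eq_cells rho rho' j w :
  (forall i, rho i = rho' i) -> cells rho j w = cells rho' j w.
Proof.
move=> e; elim: w j => //= t w IH j; rewrite IH; congr (_ :: _); congr pair.
by apply/ffunP => i; rewrite !ffunE e.
Qed.

Lemma size_cells rho j w : size (cells rho j w) = size w.
Proof. by elim: w j => //= t w IH j; rewrite IH. Qed.

Definition is_first (c : cell) : bool := c.1 == TImp.

(** This condition lets [TImp] serve as the left end marker of sweeps and as the test for position
    0. *)
Definition input_word (w : seq tok) : bool :=
  if w is t :: w' then (t == TImp) && (TImp \notin w') else false.

Notation G := (option cell).

(** The number of trailing blanks is left open because a sweep turns on a blank and leaves it on the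
    tape as a visited cell. *)
Definition tape_of (w : seq tok) (rho : nat -> nat) (tp : tape G) : Prop :=
  exists m, tp = mk_tape None [::] (map some (cells rho 0 w) ++ nseq m None).

Definition runs (M : mach G) w rho (b : bool) rho' (T : nat) : Prop :=
  forall tp, tape_of w rho tp ->
  exists2 tp', exec None M tp b tp' T & tape_of w rho' tp'.

Lemma exec_le (M : mach G) tp b tp' T T' : T <= T' ->
  exec None M tp b tp' T -> exec None M tp b tp' T'.
Proof. by move=> le [t le' e]; exists t => //; exact: leq_trans le. Qed.

Lemma runs_le M w rho b rho' T T' : T <= T' -> runs M w rho b rho' T ->
  runs M w rho b rho' T'.
Proof. by move=> le h tp /h [tp' e ?]; exists tp' => //; exact: exec_le e. Qed.

Lemma eq_runs M w rho1 rho1' b rho2 rho2' T :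
  rho1 =1 rho1' -> rho2 =1 rho2' -> runs M w rho1 b rho2 T -> runs M w rho1' b rho2' T.
Proof.
move=> e1 e2 h tp [m e]; case: (h tp) => [|tp' ex [m' e']].
  by exists m; rewrite e (eq_cells _ _ e1).
by exists tp' => //; exists m'; rewrite e' (eq_cells _ _ e2).
Qed.

Lemma runs_ite M1 M2 M3 w rho b rho1 T1 b' rho2 T2 :
  runs M1 w rho b rho1 T1 -> runs (if b then M2 else M3) w rho1 b' rho2 T2 ->
  runs (ite_mach M1 M2 M3) w rho b' rho2 (T1 + T2).
Proof.
move=> h1 h2 tp /h1 [tp1 e1 /h2 [tp2 e2 t2]]; exists tp2 => //.
exact: exec_ite e1 e2.
Qed.

Lemma runs_loop_exit M w rho rho' T :
  runs M w rho false rho' T -> runs (loop_mach M) w rho true rho' T.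
Proof.
by move=> h tp /h [tp' e ?]; exists tp' => //; exact: exec_loop_exit.
Qed.

Lemma runs_loop_step M w rho rho1 T1 b rho2 T2 :
  runs M w rho true rho1 T1 -> runs (loop_mach M) w rho1 b rho2 T2 ->
  runs (loop_mach M) w rho b rho2 (T1 + T2).
Proof.
move=> h1 h2 tp /h1 [tp1 e1 /h2 [tp2 e2 t2]]; exists tp2 => //.
exact: exec_loop_step e1 e2.
Qed.

Lemma runs_const w rho b : runs (const_mach G b) w rho b rho 1.
Proof. by move=> tp h; exists tp => //; exact: exec_const. Qed.

Definition seq_mach (M N : mach G) : mach G := ite_mach M N N.

Lemma runs_seq M N w rho b rho1 T1 b' rho2 T2 :
  runs M w rho b rho1 T1 -> runs N w rho1 b' rho2 T2 ->
  runs (seq_mach M N) w rho b' rho2 (T1 + T2).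
Proof. by move=> h1 h2; apply: runs_ite h1 _; case: b. Qed.

Lemma runs_sweep (S : finType) (f : S -> cell -> S * cell) s0 out w rho rho' s' :
  input_word w -> mealy f s0 (cells rho 0 w) = (s', cells rho' 0 w) ->
  runs (sweep_mach is_first f s0 out) w rho (out s') rho' (2 * size w).+1.
Proof.
case: w => // t w /andP [/eqP et nw] e tp [m ->].
exists (mk_tape None [::] (map some (cells rho' 0 (t :: w)) ++ nseq m.-1.+1 None)).
  rewrite -(size_cells rho 0); apply: exec_sweep e _ _; first by rewrite /is_first /= et.
  elim: w (1) nw => //= u w IH j; rewrite inE negb_or => /andP [nu /IH ->].
  by rewrite andbT /is_first eq_sym.
by exists m.-1.+1.
Qed.

Definition tok_mach (i : nat) (a : tok) : mach G :=
  sweep_mach is_first (fun s c => (s || mark i c && (c.1 == a), c)) false id.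

(** The state records whether mark [i] has been met, and whether mark [j] has been met together with
    it or later. For [j = i] this tests whether the register has a mark at all. *)
Definition le_mach (i j : nat) : mach G :=
  sweep_mach is_first
    (fun s c => ((s.1 || mark i c, s.2 || ((s.1 || mark i c) && mark j c)), c))
    (false, false) (fun s => s.2).

Definition zero_mach (i : nat) : mach G :=
  sweep_mach is_first (fun s c => (false, set_mark i s c)) true (fun _ => true).

Definition clear_mach (i : nat) : mach G :=
  sweep_mach is_first (fun s c => (s, set_mark i false c)) true (fun _ => true).

(** The state carries the removed mark to the next cell. From the last cell it falls off the input,
    which is the value [size w]; hence the [minn] in [runs_inc]. *)
Definition inc_mach (i : nat) : mach G :=
  sweep_mach is_first (fun s c => (mark i c, set_mark i s c)) false (fun _ => true).

Section Prims.
Variables (w : seq tok) (rho : nat -> nat) (i : nat).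
Hypotheses (hw : input_word w) (hi : i <= K).
Notation n := (size w).
Notation T := (2 * n).+1.

Lemma runs_tok a :
  runs (tok_mach i a) w rho ((rho i < n) && (nth TTop w (rho i) == a)) rho T.
Proof.
set f := fun (s : bool) (c : cell) => (s || mark i c && (c.1 == a), c).
suff e : mealy f false (cells rho 0 w) =
    ((rho i < n) && (nth TTop w (rho i) == a), cells rho 0 w) by exact: (runs_sweep id hw e).
have gen w' j s : mealy f s (cells rho j w') =
    (s || [&& j <= rho i, rho i - j < size w' & nth TTop w' (rho i - j) == a],
     cells rho j w').
  elim: w' j s => [|t w' IH] j s /=; first by rewrite andbF orbF.
  rewrite mark_cell // IH; congr pair; rewrite -orbA; congr orb.
  case: (ltngtP (rho i) j) => //= h; last by rewrite h subnn /= orbF.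
  have -> : rho i - j = (rho i - j.+1).+1 by lia.
  by rewrite ltnS.
by have := gen w 0 false; rewrite subn0.
Qed.

Lemma runs_le_mach j : j <= K ->
  runs (le_mach i j) w rho (rho i <= rho j < n) rho T.
Proof.
move=> hj; set f := fun (s : bool * bool) (c : cell) =>
  ((s.1 || mark i c, s.2 || ((s.1 || mark i c) && mark j c)), c).
suff e : mealy f (false, false) (cells rho 0 w) =
    ((rho i < n, rho i <= rho j < n), cells rho 0 w) by exact: (runs_sweep (fun s => s.2) hw e).
have gen w' k b : mealy f (rho i < k, b) (cells rho k w') =
    ((rho i < k + size w', b || [&& k <= rho j, rho i <= rho j & rho j < k + size w']),
     cells rho k w').
  elim: w' k b => [|t w' IH] k b /=.
    rewrite addn0; congr ((_, _), _).
    by case: b => //=; lia.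
  rewrite !mark_cell // -addSnnS.
  have -> : (rho i < k) || (rho i == k) = (rho i < k.+1) by lia.
  rewrite IH; congr ((_, _), _); case: b => //=; lia.
by have := gen w 0 false; rewrite ltn0 add0n.
Qed.

Lemma runs_zero : runs (zero_mach i) w rho true (upd rho i 0) T.
Proof.
have [s e] : exists s, mealy (fun s c => (false, set_mark i s c)) true (cells rho 0 w) =
   (s, cells (upd rho i 0) 0 w); last exact: (runs_sweep (fun _ => true) hw e).
case: (w) => [|t w']; first by exists true.
exists false => /=; rewrite (@set_mark_cell _ _ _ _ 0) //.
suff gen j : 0 < j -> mealy (fun s c => (false, set_mark i s c)) false (cells rho j w') =
   (false, cells (upd rho i 0) j w') by rewrite gen.
elim: w' j => //= u w' IH j jp; rewrite IH // (@set_mark_cell _ _ _ _ 0) //.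
by case: j jp.
Qed.

Lemma runs_clear : runs (clear_mach i) w rho true (upd rho i n) T.
Proof.
suff e : mealy (fun s c => (s, set_mark i false c)) true (cells rho 0 w) =
   (true, cells (upd rho i n) 0 w) by exact: (runs_sweep (fun _ => true) hw e).
suff gen w' j m : j + size w' <= m ->
  mealy (fun s c => (s, set_mark i false c)) true (cells rho j w') =
   (true, cells (upd rho i m) j w') by exact: gen.
elim: w' j => //= u w' IH j le; rewrite IH ?(@set_mark_cell _ _ _ _ m) //; lia.
Qed.

Lemma runs_inc : runs (inc_mach i) w rho true (upd rho i (minn (rho i).+1 n)) T.
Proof.
have [s e] : exists s, mealy (fun s c => (mark i c, set_mark i s c)) false (cells rho 0 w) =
   (s, cells (upd rho i (minn (rho i).+1 n)) 0 w); last exact: (runs_sweep (fun _ => true) hw e).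
suff gen w' j m : j + size w' <= m -> exists s,
  mealy (fun s c => (mark i c, set_mark i s c)) ((rho i).+1 == j) (cells rho j w') =
   (s, cells (upd rho i (minn (rho i).+1 m)) j w') by have := gen w 0 n; apply.
elim: w' j => [|u w' IH] j /= le; first by eexists.
case: (IH j.+1) => [|s e]; first by lia.
exists s; rewrite mark_cell // -eqSS e (@set_mark_cell _ _ _ _ (minn (rho i).+1 m)) //; lia.
Qed.

End Prims.

End Pebbles.

(** * Bounded loop expressions and their compilation *)

Inductive expr : Type :=
| EBool (b : bool)
| ETok (i : nat) (a : tok)
| ELe (i j : nat)
| EIte (e1 e2 e3 : expr)
| EFold (e f : expr).

(* Registers are numbered by binding depth.  [EFold e f] runs, with [a], [x], [y]
   in three fresh registers, [a := 0; for x < n, for y < n, if e then a := a + 1]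
   and then [f] with only [a] left. *)
Fixpoint evale (w : seq tok) (env : seq nat) (e : expr) : bool :=
  let n := size w in
  match e with
  | EBool b => b
  | ETok i a => (nth n env i < n) && (nth TTop w (nth n env i) == a)
  | ELe i j => nth n env i <= nth n env j < n
  | EIte e1 e2 e3 => if evale w env e1 then evale w env e2 else evale w env e3
  | EFold e f =>
      evale w (rcons env
        (foldl (fun a x => foldl (fun a y =>
             if evale w (env ++ [:: a; x; y]) e then minn a.+1 n else a)
           a (iota 0 n)) 0 (iota 0 n))) f
  end.

Fixpoint ewf (K d : nat) (e : expr) : bool :=
  match e with
  | EBool _ => true
  | ETok i _ => i <= K
  | ELe i j => (i <= K) && (j <= K)
  | EIte e1 e2 e3 => [&& ewf K d e1, ewf K d e2 & ewf K d e3]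
  | EFold e f => [&& d.+2 <= K, ewf K d.+3 e & ewf K d.+1 f]
  end.

(** * Compilation of expressions, with polynomial time bounds *)

Section Compile.
Variable K : nat.

(** A test [le_mach K i i] asks whether register [i] is still inside the input. Both loop registers
    end at [size w], hence unmarked, so only register [d] has to be cleared; the clearing occurs in
    two copies to carry the answer of [Mf] past it. *)
Definition fold_mach (d : nat) (Me Mf : mach (option (tok * {ffun 'I_K.+1 -> bool}))) :=
  let skip b := const_mach (option (tok * {ffun 'I_K.+1 -> bool})) b in
  let loopy := loop_mach (ite_mach (le_mach K d.+2 d.+2)
    (seq_mach (ite_mach Me (inc_mach K d) (skip true)) (inc_mach K d.+2)) (skip false)) in
  let loopx := loop_mach (ite_mach (le_mach K d.+1 d.+1)
    (seq_mach (zero_mach K d.+2) (seq_mach loopy (inc_mach K d.+1))) (skip false)) in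
  seq_mach (zero_mach K d) (seq_mach (zero_mach K d.+1) (seq_mach loopx
    (ite_mach Mf (seq_mach (clear_mach K d) (skip true))
                 (seq_mach (clear_mach K d) (skip false))))).

(** The default [size w] is the unmarked value, so registers beyond the environment are free and
    need no allocation. *)
Definition store (w : seq tok) (env : seq nat) : nat -> nat := nth (size w) env.

Lemma upd_store0 w env v i s :
  upd (store w (env ++ i :: s)) (size env) v =1 store w (env ++ v :: s).
Proof.
move=> k; rewrite /upd /store !nth_cat; case: eqP => [->|ne]; first by rewrite ltnn subnn.
case: ltnP => // le; have -> : k - size env = (k - size env).-1.+1 by lia.
by [].
Qed.

Lemma store_off w env s : store w (env ++ nseq s (size w)) =1 store w env.
Proof.
move=> k; rewrite /store nth_cat; case: ltnP => // le.
by rewrite nth_nseq [RHS]nth_default //; case: ifP.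
Qed.

Lemma upd_store1 w env v a i s :
  upd (store w (env ++ [:: a, i & s])) (size env).+1 v =1 store w (env ++ [:: a, v & s]).
Proof.
by rewrite -[[:: a, i & s]]cat1s -[[:: a, v & s]]cat1s !catA -(size_rcons env a) -cats1;
   exact: upd_store0.
Qed.

Lemma upd_store2 w env v a b i :
  upd (store w (env ++ [:: a; b; i])) (size env).+2 v =1 store w (env ++ [:: a; b; v]).
Proof.
have h := @upd_store0 w (env ++ [:: a; b]) v i [::].
move: h; rewrite size_cat addn2 -!catA; exact.
Qed.

Lemma store0 w env a s : store w (env ++ a :: s) (size env) = a.
Proof. by rewrite /store nth_cat ltnn subnn. Qed.

Lemma store1 w env a b s : store w (env ++ [:: a, b & s]) (size env).+1 = b.
Proof. by rewrite /store nth_cat ltnNge leqnSn /= subSnn. Qed.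

Lemma store2 w env a b c : store w (env ++ [:: a; b; c]) (size env).+2 = c.
Proof.
have -> : (size env).+2 = size env + 2 by lia.
by rewrite /store nth_cat ltnNge leq_addr /= addKn.
Qed.

Section FoldCorrect.
Variables (w : seq tok) (env : seq nat) (e f : expr).
Variables (Me Mf : mach (option (tok * {ffun 'I_K.+1 -> bool}))) (Te Tf : nat).
Hypothesis hw : input_word w.
Hypothesis hK : (size env).+2 <= K.
Notation n := (size w).
Notation d := (size env).
Notation P := (2 * size w).+1.
Hypothesis he : forall a x y,
  runs Me w (store w (env ++ [:: a; x; y])) (evale w (env ++ [:: a; x; y]) e)
    (store w (env ++ [:: a; x; y])) Te.
Hypothesis hf : forall a,
  runs Mf w (store w (env ++ [:: a])) (evale w (env ++ [:: a]) f)
    (store w (env ++ [:: a])) Tf.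

Let inner a x y :=
  if evale w (env ++ [:: a; x; y]) e then minn a.+1 n else a.

Lemma runs_inner_loop a x y : y <= n ->
  runs (loop_mach (ite_mach (le_mach K d.+2 d.+2)
    (seq_mach (ite_mach Me (inc_mach K d) (const_mach _ true)) (inc_mach K d.+2))
    (const_mach _ false))) w
   (store w (env ++ [:: a; x; y])) true
   (store w (env ++ [:: foldl (fun a y => inner a x y) a (iota y (n - y)); x; n]))
   ((n - y).+1 * (Te + 3 * P)).
Proof.
move=> le; have [k ek] : exists k, n - y = k by eexists.
elim: k y a le ek => [|k IH] y a le ek.
  have -> : y = n by lia.
  rewrite subnn /= mul1n; apply: runs_loop_exit.
  apply: (@runs_le _ _ _ _ _ _ (P + 1)); first by lia.
  apply: runs_ite (runs_le_mach hw hK hK) _.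
  rewrite store2 ltnn andbF; exact: runs_const.
rewrite ek /=; apply: (@runs_le _ _ _ _ _ _ ((P + ((Te + P) + P)) + k.+1 * (Te + 3 * P))); first by lia.
have -> : k = n - y.+1 by lia.
apply: runs_loop_step; last by apply: IH; lia.
apply: runs_ite (runs_le_mach hw hK hK) _.
rewrite store2 leqnn; have -> /= : y < n by lia.
apply: (@runs_seq _ _ _ _ _ true (store w (env ++ [:: inner a x y; x; y]))).
  apply: runs_ite (@he a x y) _; rewrite /inner; case: ifP => _.
    apply: eq_runs (runs_inc hw _); last by lia.
      by [].
    by move=> i; rewrite store0 upd_store0.
  by apply: runs_le (runs_const _); lia.
apply: eq_runs (runs_inc hw _); [by [] | | by lia].
move=> i; rewrite store2 upd_store2.
by have -> : minn y.+1 n = y.+1 by lia.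
Qed.

(** The inner register ends at [n] once a round has been made and is untouched otherwise, whence the
    conditional in the final store. *)
Lemma runs_outer_loop a x y : x <= n ->
  runs (loop_mach (ite_mach (le_mach K d.+1 d.+1)
    (seq_mach (zero_mach K d.+2) (seq_mach
      (loop_mach (ite_mach (le_mach K d.+2 d.+2)
        (seq_mach (ite_mach Me (inc_mach K d) (const_mach _ true)) (inc_mach K d.+2))
        (const_mach _ false)))
      (inc_mach K d.+1))) (const_mach _ false))) w
   (store w (env ++ [:: a; x; y])) true
   (store w (env ++ [:: foldl (fun a x => foldl (fun a y => inner a x y) a (iota 0 n))
        a (iota x (n - x)); n; if x < n then n else y]))
   ((n - x).+1 * (3 * P + n.+1 * (Te + 3 * P))).
Proof.
move=> le; have [k ek] : exists k, n - x = k by eexists.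
elim: k x y a le ek => [|k IH] x y a le ek.
  have -> : x = n by lia.
  rewrite subnn /= mul1n ltnn; apply: runs_loop_exit.
  apply: (@runs_le _ _ _ _ _ _ (P + 1)); first by lia.
  apply: runs_ite (runs_le_mach hw _ _) _; try by lia.
  rewrite store1 ltnn andbF; exact: runs_const.
rewrite ek /=; apply: (@runs_le _ _ _ _ _ _
  ((P + (P + ((n - 0).+1 * (Te + 3 * P) + P))) + k.+1 * (3 * P + n.+1 * (Te + 3 * P)))).
  by rewrite subn0; lia.
have -> : k = n - x.+1 by lia.
have -> : (if x < n then n else y) = (if x.+1 < n then n else n).
  by rewrite if_same; have -> : x < n by lia.
apply: runs_loop_step; last by apply: IH; lia.
apply: runs_ite (runs_le_mach hw _ _) _; try by lia.
rewrite store1 leqnn; have -> /= : x < n by lia.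
apply: (@runs_seq _ _ _ _ _ true (store w (env ++ [:: a; x; 0]))).
  apply: eq_runs (runs_zero hw _); [by []| |by lia].
  by move=> i; rewrite upd_store2.
apply: runs_seq; first by apply: runs_inner_loop.
rewrite subn0.
apply: eq_runs (runs_inc hw _); [by [] | | by lia].
move=> i; rewrite store1 upd_store1.
by have -> : minn x.+1 n = x.+1 by lia.
Qed.

Lemma runs_fold :
  runs (fold_mach d Me Mf) w (store w env) (evale w env (EFold e f)) (store w env)
    (P + (P + (n.+1 * (3 * P + n.+1 * (Te + 3 * P)) + (Tf + (P + 1))))).
Proof.
have n0 : 0 < n by case: (w) hw.
apply: (@runs_seq _ _ _ _ _ true (store w (env ++ [:: 0; n; n]))).
  apply: eq_runs (runs_zero hw _); last by lia.
    exact: (@store_off w env 3).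
  by move=> i; rewrite upd_store0.
apply: (@runs_seq _ _ _ _ _ true (store w (env ++ [:: 0; 0; n]))).
  apply: eq_runs (runs_zero hw _); [by []| |by lia].
  by move=> i; rewrite upd_store1.
apply: runs_seq; first by have := @runs_outer_loop 0 0 n (leq0n _); rewrite {2}subn0; apply.
rewrite if_same subn0 /=.
set a := foldl _ _ _.
have e1 b : store w (env ++ [:: b; n; n]) =1 store w (env ++ [:: b]).
  by move=> i; have := @store_off w (env ++ [:: b]) 2 i; rewrite -catA.
apply: (@runs_ite _ _ _ _ _ _ (evale w (env ++ [:: a]) f) (store w (env ++ [:: a]))).
  by apply: eq_runs (@hf a) => // i; rewrite e1.
rewrite -cats1; set b := evale _ _ _.
have cl : runs (clear_mach K d) w (store w (env ++ [:: a])) true (store w env) P.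
  apply: eq_runs (runs_clear hw _); [exact: frefl| |by lia].
  by move=> i; rewrite upd_store0; exact: (@store_off w env 1).
by case: b; apply: runs_seq cl (runs_const _).
Qed.

End FoldCorrect.

(** The two loops run [Me] at most [n.+1 ^ 2] times and add sweeps of linear length, so the cost is
    cubic apart from [Me] and [Mf]. The sweeps amount to at most 19 cubes of [n.+1], which the
    constant 20 covers. *)
Lemma fold_time n Ce ke Cf kf :
  (2 * n).+1 + ((2 * n).+1 +
    (n.+1 * (3 * (2 * n).+1 + n.+1 * (Ce * n.+1 ^ ke + 3 * (2 * n).+1)) +
    (Cf * n.+1 ^ kf + ((2 * n).+1 + 1)))) <= (Ce + Cf + 20) * n.+1 ^ (ke + kf + 3).
Proof.
set N := n.+1; set Z := N ^ (ke + kf + 3).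
have mono i j : i <= j -> N ^ i <= N ^ j by move=> h; rewrite leq_pexp2l.
have h1 : N * (N * N ^ ke) <= Z by rewrite -!expnS mono //; lia.
have h2 : N ^ kf <= Z by rewrite mono //; lia.
have h3 : N * (N * N) <= Z by rewrite -[N in N * (N * N)]expn1 -!expnD mono //; lia.
have h4 : N <= N * N by rewrite leq_pmull.
have h5 : N * N <= N * (N * N) by rewrite leq_pmull.
have hP : (2 * n).+1 <= 2 * N by lia.
have -> : N * (3 * (2 * n).+1 + N * (Ce * N ^ ke + 3 * (2 * n).+1)) =
  3 * (N * (2 * n).+1) + Ce * (N * (N * N ^ ke)) + 3 * (N * (N * (2 * n).+1)) by nia.
have g1 : N * (2 * n).+1 <= 2 * (N * N) by nia.
have g2 : N * (N * (2 * n).+1) <= 2 * (N * (N * N)) by nia.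
have g3 : Ce * (N * (N * N ^ ke)) <= Ce * Z by rewrite leq_mul2l h1 orbT.
have g4 : Cf * N ^ kf <= Cf * Z by rewrite leq_mul2l h2 orbT.
move: g1 g2 g3 g4 h3 h4 h5 hP; rewrite !mulnDl; lia.
Qed.

(** Machine and bound depend on the environment only through its length, which fixes the registers.
    Restoring the store is what allows subexpressions to be chained. *)
Lemma compile e d : ewf K d e ->
  exists M : mach (option (tok * {ffun 'I_K.+1 -> bool})), exists C, exists k,
  forall w env, input_word w -> size env = d ->
  runs M w (store w env) (evale w env e) (store w env) (C * (size w).+1 ^ k).
Proof.
have prim n : (2 * n).+1 <= 2 * n.+1 ^ 1 by rewrite expn1; lia.
elim: e d => [b|i a|i j|e1 IH1 e2 IH2 e3 IH3|e IHe f IHf] d /=.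
- by move=> _; exists (const_mach _ b), 1, 0 => w env _ _; exact: runs_const.
- move=> hi; exists (tok_mach K i a), 2, 1 => w env hw _.
  exact: runs_le (prim _) (runs_tok hw hi _).
- move=> /andP [hi hj]; exists (le_mach K i j), 2, 1 => w env hw _.
  exact: runs_le (prim _) (runs_le_mach hw hi hj).
- case/and3P => /IH1 [M1 [C1 [k1 h1]]] /IH2 [M2 [C2 [k2 h2]]] /IH3 [M3 [C3 [k3 h3]]].
  exists (ite_mach M1 M2 M3), (C1 + C2 + C3), (k1 + k2 + k3) => w env hw hd.
  set N := (size w).+1.
  have mono i j : i <= j -> N ^ i <= N ^ j by move=> h; rewrite leq_pexp2l.
  apply: (@runs_le _ _ _ _ _ _ (C1 * N ^ k1 + (C2 * N ^ k2 + C3 * N ^ k3))).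
    rewrite -addnA !mulnDl; apply: leq_add; last apply: leq_add; rewrite leq_mul2l mono ?orbT //; lia.
  apply: runs_ite (h1 w env hw hd) _; case: (evale w env e1).
    by apply: runs_le (h2 w env hw hd); exact: leq_addr.
  by apply: runs_le (h3 w env hw hd); exact: leq_addl.
- case/and3P => hK /IHe [Me [Ce [ke he]]] /IHf [Mf [Cf [kf hf]]].
  exists (fold_mach d Me Mf), (Ce + Cf + 20), (ke + kf + 3) => w env hw hd.
  apply: (runs_le (fold_time _ _ _ _ _)); subst d; apply: runs_fold => //.
    by move=> a x y; apply: he => //; rewrite size_cat addn3.
  by move=> a; apply: hf => //; rewrite size_cat addn1.
Qed.

End Compile.

Lemma notin_imp_enc f : TImp \notin enc_f f.
Proof.
elim: f => [n||a IHa b IHb|a IHa] //=; rewrite inE ?mem_cat ?negb_or ?IHa //=.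
rewrite /= andbT /nat_bits; case: N.of_nat => // x.
by elim: x => //= x IH; rewrite inE.
Qed.

Lemma input_word_enc i : input_word (enc i).
Proof. by rewrite /= mem_cat negb_or !notin_imp_enc. Qed.

Lemma poly_time_expr (K : nat) (e : expr) (P : spi -> Prop) :
  ewf K 0 e -> (forall i, evale (enc i) [::] e <-> P i) -> poly_time_decidable P.
Proof.
move=> /compile [M [C [k hM]]] hP.
pose TMM := @Build_TM (mst M + bool)%type (option (tok * {ffun 'I_K.+1 -> bool})) None
  (fun t => Some (t, [ffun => false])) (inl (mstart M))
  (fun s => if s is inr _ then true else false) (fun s => if s is inr b then b else false)
  (fun s a => if s is inl s then mdelta s a else (s, a, Stay)).
pose conv (c : (mst M + bool) * tape (option (tok * {ffun 'I_K.+1 -> bool}))) : config TMM :=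
  let: (s, (l, a, rr)) := c in (s, l, a, rr).
have stepE c : @Defs.step TMM (conv c) = conv (mstep None c).
  case: c => [[s|b] [[l a] rr]] //=.
  case: (mdelta s a) => [[s' b] []] //=; by case: l => //; case: rr.
exists TMM, C, k => i /=.
set w := enc i; have iw : input_word w := input_word_enc i.
have t0 : tape_of w (store w [::]) (mk_tape None [::] (map some (cells K (store w [::]) 0 w))).
  by exists 0; rewrite cats0.
have initE : @Defs.init TMM w =
    conv (inl (mstart M), mk_tape None [::] (map some (cells K (store w [::]) 0 w))).
  (* In the empty environment all registers hold [size w], so no cell is marked, just as on the
     initial tape. *)
  have ei : map (@inp TMM) w = map some (cells K (store w [::]) 0 w).
    suff gen w' j n : j + size w' <= n ->
      map (@inp TMM) w' = map some (cells K (nth n [::]) j w') by exact: gen.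
    elim: w' j => //= t w' IH j le.
    rewrite -IH; last by lia.
    congr (_ :: _); congr Some; congr pair; apply/ffunP => x; rewrite !ffunE nth_nil.
    by apply/esym/eqP; lia.
  by rewrite /Defs.init ei; case: (w) iw.
have [tp' [t le et] _] := hM w [::] iw erefl _ t0.
have -> : @Defs.run TMM (C * (size w).+1 ^ k) w = conv (inr (evale w [::] e), tp').
  (* Halting states are absorbing, so the steps left up to the time bound change nothing. *)
  rewrite /Defs.run initE -(subnK le) iterD.
  set c := (inl _, _) in et *.
  have itE m x : iter m (@Defs.step TMM) (conv x) = conv (iter m (@mstep _ None M) x).
    by elim: m => //= m ->.
  by rewrite itE et itE iter_mstep_inr.
by case: tp' {et} => [[]] /=; split=> //; exact: hP.
Qed.

(** * The criterion as an expression over input positions *)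

Definition ENot (e : expr) : expr := EIte e (EBool false) (EBool true).
Definition EAnd (e1 e2 : expr) : expr := EIte e1 e2 (EBool false).
Definition EOr (e1 e2 : expr) : expr := EIte e1 (EBool true) e2.
Definition EDiff (e1 e2 : expr) : expr := EIte e2 (EBool false) e1.
Definition ELt (i j : nat) : expr := EDiff (ELe i i) (ELe j i).

(* A binder passes to its body the next free register and the bound one.  As
   [TImp] occurs only at position 0, [ETok i TImp] tests that register [i] is 0. *)
Definition EEx (d : nat) (b : nat -> nat -> expr) : expr :=
  EFold (b d.+3 d.+1) (ENot (ETok d TImp)).

(** Requiring the inner loop variable to be 0 makes each position count once. The second count runs
    one register higher, as the first result is still held in [d]. *)
Definition ECntEq (d : nat) (b1 b2 : nat -> nat -> expr) : expr :=
  EFold (EAnd (ETok d.+2 TImp) (b1 d.+3 d.+1))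
    (EFold (EAnd (ETok d.+3 TImp) (b2 d.+4 d.+2))
      (EAnd (ELe d d.+1) (ELe d.+1 d))).

Definition EDown (x : nat) : expr := EOr (ETok x TTop) (ETok x TEnd).
(** [TImp] counts as a node: it acts as a diamond whose operand is the antecedent. *)
Definition ENode (x : nat) : expr := EOr (ETok x TDia) (ETok x TImp).

(** For a node [x], its operand ends at the first leaf before which as many leaves as conjunctions
    have been read since [x]; the excluded [z] is such an end strictly before [y]. *)
Definition EScope (d x y : nat) : expr :=
  EDiff (ELe x y) (EEx d (fun d z =>
    EAnd (ELe x z) (EAnd (ELt z y) (EAnd (EDown z)
      (ECntEq d (fun _ u => EAnd (ELe x u) (EAnd (ELt u z) (EDown u)))
                (fun _ u => EAnd (ELe x u) (EAnd (ELt u z) (ETok u TAnd)))))))).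

Definition EInner (d x v : nat) : expr :=
  EDiff (EScope d x v) (EEx d (fun d z =>
    EAnd (ELt x z) (EAnd (ENode z) (EScope d z v)))).

Definition toks : seq tok := [:: TVar; TB0; TB1; TEnd; TTop; TAnd; TDia; TImp].

Definition ESameTok (u v : nat) : expr :=
  foldr (fun a e => EOr (EAnd (ETok u a) (ETok v a)) e) (EBool false) toks.

(** Each token of the first name, its [TEnd] included, must recur at the same offset in the second;
    including [TEnd] rules out proper prefixes. Offsets are compared by counting positions. *)
Definition ESame (d v v' : nat) : expr :=
  ENot (EEx d (fun d u => EAnd (ELe v u) (EAnd
    (ENot (EEx d (fun _ t => EAnd (ELe v t) (EAnd (ELt t u) (ETok t TEnd)))))
    (ENot (EEx d (fun d u' => EAnd (ELe v' u') (EAnd (ESameTok u u')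
      (ECntEq d (fun _ t => EAnd (ELe v t) (ELt t u))
                (fun _ t => EAnd (ELe v' t) (ELt t u')))))))))).

Definition EHasVar (d x v : nat) : expr :=
  EEx d (fun d v' => EAnd (ETok v' TVar) (EAnd (EInner d x v') (ESame d v v'))).

Definition ESub (d x x' : nat) : expr :=
  ENot (EEx d (fun d v => EAnd (ETok v TVar) (EAnd (EInner d x v) (ENot (EHasVar d x' v))))).

(** Register [d] is the greedy pointer into the branch of [e]. For each node [d.+1] above [t] the
    inner loop advances it until it rests on a node of that branch with enough variables; the search
    succeeds if the pointer has not passed [e]. *)
Definition EEmb (d t e : nat) : expr :=
  EFold (EAnd (ENode d.+1) (EAnd (EScope d.+3 d.+1 t)
           (ENot (EAnd (ENode d) (EAnd (EScope d.+3 d e) (ESub d.+3 d.+1 d))))))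
    (ELe d e).

(** With [z] at position 0, the whole antecedent is in the scope of [z]. So a variable under no node
    is a top-level variable of the consequent, and a diamond outside that scope ends a branch of the
    consequent. *)
Definition ELinAt (d z : nat) : expr :=
  EAnd
    (ENot (EEx d (fun d v => EAnd (ETok v TVar) (EAnd
       (ENot (EEx d (fun d x => EAnd (ENode x) (EScope d x v))))
       (ENot (EHasVar d z v))))))
    (ENot (EEx d (fun d t => EAnd (ETok t TDia) (EAnd (ENot (EScope d z t))
       (ENot (EEx d (fun d e => EAnd (ENode e) (EAnd (EScope d z e) (EEmb d t e))))))))).

Definition ELin : expr := EEx 0 (fun d z => EAnd (ETok z TImp) (ELinAt d z)).

Lemma eq_foldl_in (A : Type) (f g : A -> nat -> A) a s :
  (forall a x, x \in s -> f a x = g a x) -> foldl f a s = foldl g a s.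
Proof.
elim: s a => //= x s IH a h; rewrite h ?mem_head // IH // => b y ys.
by apply: h; rewrite inE ys orbT.
Qed.

(** * The expressions as Boolean predicates on positions *)

Section Positions.
Variable w : seq tok.
Notation n := (size w).
Notation pos := (iota 0 (size w)).

Definition tk (x : nat) (a : tok) : bool := (x < n) && (nth TTop w x == a).
Definition down_at (x : nat) : bool := tk x TTop || tk x TEnd.
Definition node_at (x : nat) : bool := tk x TDia || tk x TImp.

Definition scope (x y : nat) : bool :=
  (x <= y < n) && ~~ has (fun z => [&& x <= z, z < y, down_at z &
    count (fun u => [&& x <= u, u < z & down_at u]) pos ==
    count (fun u => [&& x <= u, u < z & tk u TAnd]) pos]) pos.

Definition inner (x v : nat) : bool :=
  scope x v && ~~ has (fun z => [&& x < z, node_at z & scope z v]) pos.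

Definition same_name (v v' : nat) : bool :=
  ~~ has (fun u => [&& v <= u,
    ~~ has (fun t => [&& v <= t, t < u & tk t TEnd]) pos &
    ~~ has (fun u' => [&& v' <= u', nth TTop w u == nth TTop w u' &
       count (fun t => v <= t < u) pos == count (fun t => v' <= t < u') pos]) pos]) pos.

Definition has_var (x v : nat) : bool :=
  has (fun v' => [&& tk v' TVar, inner x v' & same_name v v']) pos.

Definition sub_at (x x' : nat) : bool :=
  ~~ has (fun v => [&& tk v TVar, inner x v & ~~ has_var x' v]) pos.

Definition emb_at (t e : nat) : bool :=
  foldl (fun a x => foldl (fun a y =>
    if [&& node_at x, scope x t & ~~ [&& node_at a, scope a e & sub_at x a]]
    then minn a.+1 n else a) a pos) 0 pos <= e < n.

Definition lin_at (z : nat) : bool :=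
  ~~ has (fun v => [&& tk v TVar, ~~ has (fun x => node_at x && scope x v) pos &
    ~~ has_var z v]) pos &&
  ~~ has (fun t => [&& tk t TDia, ~~ scope z t &
    ~~ has (fun e => [&& node_at e, scope z e & emb_at t e]) pos]) pos.

(** The bound on [i] makes the fact stable when an inner binder extends the environment. *)
Definition reg (env : seq nat) (i x : nat) : Prop := i < size env /\ nth n env i = x.

Lemma reg_cat env s i x : reg env i x -> reg (env ++ s) i x.
Proof. by move=> [h e]; split; rewrite ?size_cat ?nth_cat ?h //; lia. Qed.

Lemma reg_rcons env a i x : reg env i x -> reg (rcons env a) i x.
Proof. by rewrite -cats1; exact: reg_cat. Qed.

Lemma reg_new0 env d a s : d = size env -> reg (env ++ a :: s) d a.
Proof. by move=> ->; split; rewrite ?size_cat ?nth_cat ?ltnn ?subnn //=; lia. Qed.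

Lemma reg_new1 env d a b s : d = size env -> reg (env ++ [:: a, b & s]) d.+1 b.
Proof. by move=> ->; split; rewrite ?size_cat ?nth_cat ?ltnNge ?leqnSn ?subSnn //=; lia. Qed.

Lemma reg_new2 env d a b c s : d = size env -> reg (env ++ [:: a, b, c & s]) d.+2 c.
Proof.
move=> ->; rewrite -[[:: a, b, c & s]]/([:: a] ++ [:: b, c & s]) catA.
by apply: reg_new1; rewrite size_cat addn1.
Qed.

Lemma reg_last env d a : d = size env -> reg (rcons env a) d a.
Proof. by rewrite -cats1; exact: reg_new0. Qed.

Lemma size_env3 env d (a x y : nat) : d = size env -> d.+3 = size (env ++ [:: a; x; y]).
Proof. by move=> ->; rewrite size_cat addn3. Qed.

Lemma size_env1 env d (a : nat) : d = size env -> d.+1 = size (rcons env a).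
Proof. by move=> ->; rewrite size_rcons. Qed.

Hint Resolve reg_cat reg_rcons reg_new0 reg_new1 reg_new2 reg_last size_env3 size_env1 : regs.

Lemma evale_tok env i x a : reg env i x -> evale w env (ETok i a) = tk x a.
Proof. by case=> _ /= ->. Qed.

Lemma evale_le env i j x y : reg env i x -> reg env j y ->
  evale w env (ELe i j) = (x <= y < n).
Proof. by case=> _ /= -> [_ ->]. Qed.

Lemma evale_not env e : evale w env (ENot e) = ~~ evale w env e.
Proof. by rewrite /=; case: ifP. Qed.

Lemma evale_and env e1 e2 :
  evale w env (EAnd e1 e2) = evale w env e1 && evale w env e2.
Proof. by rewrite /=; case: ifP. Qed.

Lemma evale_or env e1 e2 :
  evale w env (EOr e1 e2) = evale w env e1 || evale w env e2.
Proof. by rewrite /=; case: ifP. Qed.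

Lemma evale_diff env e1 e2 :
  evale w env (EDiff e1 e2) = evale w env e1 && ~~ evale w env e2.
Proof. by rewrite /=; case: ifP => _; rewrite ?andbF ?andbT. Qed.

Lemma evale_fold env e f : evale w env (EFold e f) =
  evale w (rcons env (foldl (fun a x => foldl (fun a y =>
    if evale w (env ++ [:: a; x; y]) e then minn a.+1 n else a) a pos) 0 pos)) f.
Proof. by []. Qed.

Lemma evale_lt env i j x y : reg env i x -> reg env j y -> x < n ->
  evale w env (ELt i j) = (x < y).
Proof.
move=> ri rj xn; rewrite evale_diff (evale_le ri ri) (evale_le rj ri).
by rewrite leqnn xn /= andbT ltnNge.
Qed.

Hypothesis hw : input_word w.

Lemma tk_imp x : tk x TImp = (x == 0).
Proof.
move: hw; rewrite /tk; case: (w) => // t w' /andP [/eqP -> nw].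
case: x => [|x] //=; rewrite ltnS; case: ltnP => //= h; apply/negbTE.
by apply: contra nw => /eqP <-; exact: mem_nth.
Qed.

Lemma size_gt0 : 0 < n. Proof. by case: (w) hw. Qed.

Lemma evale_ex (P : pred nat) env d b : d = size env ->
  (forall a x y, x < n -> evale w (env ++ [:: a; x; y]) (b d.+3 d.+1) = P x) ->
  evale w env (EEx d b) = has P pos.
Proof.
move=> hd hP; rewrite /EEx [LHS]/=.
set A := foldl _ _ _.
have rA : reg (rcons env A) d A by exact: reg_last.
have -> : (if (nth n (rcons env A) d < n) && (nth TTop w (nth n (rcons env A) d) == TImp)
  then false else true) = ~~ tk A TImp by case: rA => _ ->; rewrite /tk; case: ifP.
rewrite tk_imp -lt0n /A.
have n0 := size_gt0.
have inn x s : x < n -> forall a, (0 < foldl (fun a y =>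
   if evale w (env ++ [:: a; x; y]) (b d.+3 d.+1) then minn a.+1 n else a) a s) =
   (0 < a) || P x && (0 < size s).
  move=> xn; elim: s => [|y s IH] a /=; first by rewrite andbF orbF.
  by rewrite hP // IH; case: (P x) => //=; rewrite orbT; lia.
suff gen s a : all (fun x => x < n) s ->
   (0 < foldl (fun a x => foldl (fun a y =>
   if evale w (env ++ [:: a; x; y]) (b d.+3 d.+1) then minn a.+1 n else a) a pos) a s)
   = (0 < a) || has P s.
  by rewrite gen //; apply/allP => x; rewrite mem_iota; lia.
elim: s a => [|x s IH] a /=; first by rewrite orbF.
by case/andP=> xn /IH ->; rewrite inn // size_iota n0 andbT orbA.
Qed.

Lemma fold_count (P : pred nat) env d e : d = size env ->
  (forall a x y, x < n -> evale w (env ++ [:: a; x; y]) e = P x) ->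
  foldl (fun a x => foldl (fun a y =>
    if evale w (env ++ [:: a; x; y]) (EAnd (ETok d.+2 TImp) e) then minn a.+1 n else a)
    a pos) 0 pos = minn (count P pos) n.
Proof.
move=> hd hP; have n0 := size_gt0.
have inn x a : x < n -> foldl (fun a y =>
   if evale w (env ++ [:: a; x; y]) (EAnd (ETok d.+2 TImp) e) then minn a.+1 n else a) a pos =
   if P x then minn a.+1 n else a.
  move=> xn; have step y a' : (if evale w (env ++ [:: a'; x; y]) (EAnd (ETok d.+2 TImp) e)
      then minn a'.+1 n else a') = if (y == 0) && P x then minn a'.+1 n else a'.
    by rewrite evale_and (@evale_tok _ _ y) ?hP ?tk_imp //; exact: reg_new2.
  rewrite (eq_foldl_in (g := fun a y => if (y == 0) && P x then minn a.+1 n else a)); last first.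
    by move=> a' y _; exact: step.
  have tail k j a' : 0 < j ->
      foldl (fun a y => if (y == 0) && P x then minn a.+1 n else a) a' (iota j k) = a'.
    by elim: k j a' => //= k IH j a' j0; rewrite IH // -[j == 0]negbK -lt0n j0.
  by rewrite -[X in iota 0 X](prednK n0) [iota _ _]/= [LHS]/= tail.
suff gen s a : a <= n -> all (fun x => x < n) s ->
  foldl (fun a x => foldl (fun a y =>
    if evale w (env ++ [:: a; x; y]) (EAnd (ETok d.+2 TImp) e) then minn a.+1 n else a)
    a pos) a s = minn (a + count P s) n.
  by rewrite gen //; apply/allP => x; rewrite mem_iota; lia.
elim: s a => [|x s IH] a an /=; first by lia.
case/andP=> xn ax; rewrite inn // IH //; last by case: (P x); lia.
by case: (P x); lia.
Qed.

(** Counters saturate at [n], and a register holding [n] has no mark for [ELe] to compare; hence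
    both counts must be below [n]. *)
Lemma evale_cnteq (P Q : pred nat) env d b1 b2 : d = size env ->
  count P pos < n -> count Q pos < n ->
  (forall a x y, x < n -> evale w (env ++ [:: a; x; y]) (b1 d.+3 d.+1) = P x) ->
  (forall c a x y, x < n ->
     evale w (rcons env c ++ [:: a; x; y]) (b2 d.+4 d.+2) = Q x) ->
  evale w env (ECntEq d b1 b2) = (count P pos == count Q pos).
Proof.
move=> hd cP cQ hP hQ; rewrite /ECntEq.
rewrite evale_fold (fold_count hd hP) evale_fold (fold_count (size_env1 _ hd) (hQ _)).
rewrite !(minn_idPl (ltnW _)) // evale_and.
have r1 : reg (rcons (rcons env (count P pos)) (count Q pos)) d (count P pos).
  by auto with regs.
have r2 : reg (rcons (rcons env (count P pos)) (count Q pos)) d.+1 (count Q pos).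
  by auto with regs.
by rewrite (evale_le r1 r2) (evale_le r2 r1) cP cQ !andbT -eqn_leq.
Qed.

Lemma evale_down env x X : reg env x X -> evale w env (EDown x) = down_at X.
Proof. by move=> r; rewrite evale_or !(evale_tok _ r). Qed.

Lemma evale_node env x X : reg env x X -> evale w env (ENode x) = node_at X.
Proof. by move=> r; rewrite evale_or !(evale_tok _ r). Qed.

Lemma count_lt (P : pred nat) z : z < n -> (forall u, P u -> u < z) -> count P pos < n.
Proof.
move=> zn hP; apply: leq_ltn_trans (zn).
rewrite -(subnKC (ltnW zn)) iotaD count_cat.
have -> : count P (iota (0 + z) (n - z)) = 0.
  apply/eqP; rewrite -leqn0 leqNgt -has_count; apply/negP => /hasP [u].
  by rewrite mem_iota => h /hP; lia.
by rewrite addn0 -[X in _ <= X](size_iota 0); exact: count_size.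
Qed.

Ltac regs :=
  lazymatch goal with
  | |- reg _ _ _ => first
      [ assumption
      | simple apply reg_new1; solve [regs] | simple apply reg_new0; solve [regs]
      | simple apply reg_last; solve [regs]
      | simple apply reg_cat; regs | simple apply reg_rcons; regs ]
  | |- _ = size _ => first
      [ assumption | simple apply size_env3; regs | simple apply size_env1; regs ]
  | |- is_true (_ < size _) => assumption
  end.

Lemma evale_scope env d x y X Y : d = size env -> reg env x X -> reg env y Y ->
  evale w env (EScope d x y) = scope X Y.
Proof.
move=> hd rx ry; rewrite evale_diff (evale_le rx ry); congr (_ && ~~ _).
apply: evale_ex => // a z y' zn; rewrite !evale_and.
rewrite (@evale_le _ _ _ X z) ?(@evale_lt _ _ _ z Y) ?(@evale_down _ _ z); try regs.
rewrite zn andbT; congr [&& _, _, _ & _].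
apply: evale_cnteq; try regs; try by apply: (count_lt zn) => u /and3P [].
  move=> b u y2 un; rewrite !evale_and.
  rewrite (@evale_le _ _ _ X u) ?(@evale_lt _ _ _ u z) ?(@evale_down _ _ u); try regs.
  by rewrite un andbT.
move=> c b u y2 un; rewrite !evale_and.
rewrite (@evale_le _ _ _ X u) ?(@evale_lt _ _ _ u z) ?(@evale_tok _ _ u); try regs.
by rewrite un andbT.
Qed.

Lemma evale_inner env d x v X V : d = size env -> reg env x X -> reg env v V -> X < n ->
  evale w env (EInner d x v) = inner X V.
Proof.
move=> hd rx rv Xn; rewrite evale_diff (evale_scope hd rx rv); congr (_ && ~~ _).
apply: evale_ex => // a z y zn; rewrite !evale_and.
by rewrite (@evale_lt _ _ _ X z) ?(@evale_node _ _ z) ?(@evale_scope _ _ _ _ z V); try regs.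
Qed.

Lemma evale_sametok env u v U V : reg env u U -> reg env v V -> U < n -> V < n ->
  evale w env (ESameTok u v) = (nth TTop w U == nth TTop w V).
Proof.
move=> ru rv Un Vn; rewrite /ESameTok.
have -> : (nth TTop w U == nth TTop w V) = has (fun a => tk U a && tk V a) toks.
  rewrite /tk Un Vn; apply/eqP/hasP => [e|[a _ /andP [/eqP -> /eqP ->]] //].
  by exists (nth TTop w U); [case: (nth _ _ _) | rewrite e eqxx].
elim: toks => // a s IH; rewrite [foldr _ _ _]/= evale_or evale_and.
by rewrite (evale_tok _ ru) (evale_tok _ rv) IH.
Qed.

Lemma evale_same env d v v' V V' : d = size env -> reg env v V -> reg env v' V' ->
  evale w env (ESame d v v') = same_name V V'.
Proof.
move=> hd rv rv'; rewrite evale_not; congr (~~ _).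
apply: evale_ex => // a u y un; rewrite !evale_and !evale_not.
rewrite (@evale_le _ _ _ V u); try regs.
rewrite un andbT; congr [&& _, ~~ _ & ~~ _].
  apply: evale_ex; try regs; move=> a2 t y2 tn; rewrite !evale_and.
  rewrite (@evale_le _ _ _ V t) ?(@evale_lt _ _ _ t u) ?(@evale_tok _ _ t); try regs.
  by rewrite tn andbT.
apply: evale_ex; try regs; move=> a2 u' y2 u'n; rewrite !evale_and.
rewrite (@evale_le _ _ _ V' u') ?(@evale_sametok _ _ _ u u'); try regs.
rewrite u'n andbT; congr [&& _, _ & _].
apply: evale_cnteq; try regs.
- by apply: (count_lt un) => t /andP [].
- by apply: (count_lt u'n) => t /andP [].
- move=> b t y3 tn; rewrite !evale_and.
  rewrite (@evale_le _ _ _ V t) ?(@evale_lt _ _ _ t u); try regs.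
  by rewrite tn andbT.
- move=> c b t y3 tn; rewrite !evale_and.
  rewrite (@evale_le _ _ _ V' t) ?(@evale_lt _ _ _ t u'); try regs.
  by rewrite tn andbT.
Qed.

Lemma evale_hasvar env d x v X V : d = size env -> reg env x X -> reg env v V -> X < n ->
  evale w env (EHasVar d x v) = has_var X V.
Proof.
move=> hd rx rv Xn; apply: evale_ex => // a v' y v'n; rewrite !evale_and.
by rewrite (@evale_tok _ _ v') ?(@evale_inner _ _ _ _ X v') ?(@evale_same _ _ _ _ V v'); try regs.
Qed.

Lemma evale_sub env d x x' X X' : d = size env -> reg env x X -> reg env x' X' ->
  X < n -> X' < n -> evale w env (ESub d x x') = sub_at X X'.
Proof.
move=> hd rx rx' Xn X'n; rewrite evale_not; congr (~~ _).
apply: evale_ex => // a v y vn; rewrite !evale_and evale_not.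
by rewrite (@evale_tok _ _ v) ?(@evale_inner _ _ _ _ X v) ?(@evale_hasvar _ _ _ _ X' v); try regs.
Qed.

Lemma node_at_lt x : node_at x -> x < n.
Proof. by case/orP => /andP []. Qed.

Lemma evale_emb env d t e T E : d = size env -> reg env t T -> reg env e E ->
  evale w env (EEmb d t e) = emb_at T E.
Proof.
move=> hd rt re; rewrite /EEmb /emb_at; set b := EAnd _ _; rewrite evale_fold.
set A := foldl _ _ _; set B := foldl _ _ _.
suff -> : A = B.
  by rewrite (@evale_le _ _ _ B E); try regs.
suff h a x y : evale w (env ++ [:: a; x; y]) b =
    [&& node_at x, scope x T & ~~ [&& node_at a, scope a E & sub_at x a]].
  by apply: eq_foldl_in => a x _; apply: eq_foldl_in => a' y _; rewrite h.
rewrite /b !evale_and evale_not !evale_and.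
rewrite (@evale_node _ d.+1 x) ?(@evale_node _ d a) ?(@evale_scope _ _ d.+1 t x T)
  ?(@evale_scope _ _ d e a E); try regs.
(* [evale_sub] needs positions inside the input, while the pointer [a] may have reached [n]; the
   preceding node tests provide the bounds. *)
case: (boolP (node_at x)) => // /node_at_lt xn.
case: (boolP (node_at a)) => // /node_at_lt an.
by rewrite (@evale_sub _ _ _ _ x a); try regs.
Qed.

Lemma evale_lin_at env d z Z : d = size env -> reg env z Z -> Z < n ->
  evale w env (ELinAt d z) = lin_at Z.
Proof.
move=> hd rz Zn; rewrite evale_and !evale_not; congr (~~ _ && ~~ _).
  apply: evale_ex => // a2 v y2 vn; rewrite !evale_and !evale_not.
  rewrite (@evale_tok _ _ v) ?(@evale_hasvar _ _ _ _ Z v); try regs.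
  congr [&& _, ~~ _ & _].
  apply: evale_ex => [|a3 x y3 xn]; first by regs.
  rewrite !evale_and.
  by rewrite (@evale_node _ _ x) ?(@evale_scope _ _ _ _ x v); try regs.
apply: evale_ex => // a2 t y2 tn; rewrite !evale_and !evale_not.
rewrite (@evale_tok _ _ t) ?(@evale_scope _ _ _ _ Z t); try regs.
congr [&& _, _ & ~~ _].
apply: evale_ex => [|a3 e y3 en]; first by regs.
rewrite !evale_and.
by rewrite (@evale_node _ _ e) ?(@evale_scope _ _ _ _ Z e) ?(@evale_emb _ _ _ _ t e); try regs.
Qed.

Lemma evale_lin : evale w [::] ELin = lin_at 0.
Proof.
rewrite /ELin (@evale_ex (fun z => (z == 0) && lin_at z)) //.
  apply/hasP/idP => [[z _ /andP [/eqP ->]] //|h]; exists 0; rewrite ?mem_iota ?size_gt0 //.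
move=> a z y zn; have rz : reg ([::] ++ [:: a; z; y]) 1 z by exact: reg_new1.
by rewrite evale_and (evale_tok _ rz) tk_imp (evale_lin_at _ rz).
Qed.

End Positions.

(** The expression does not depend on the input, so its binding depth is a constant; 60 is a
    generous bound on its registers. *)
Lemma ewf_ELin : ewf 60 0 ELin.
Proof. by vm_compute. Qed.

(** * Positions and subformula occurrences *)

Definition down_tok (t : tok) : bool := (t == TTop) || (t == TEnd).

Definition bit_tok (t : tok) : bool := (t == TB0) || (t == TB1).

Lemma nat_bits_bit m : all bit_tok (nat_bits m).
Proof.
rewrite /nat_bits; case: N.of_nat => // x; by elim: x => //= x ->.
Qed.

Fixpoint bits_val (s : seq tok) : nat :=
  match s with
  | TB0 :: s' => (bits_val s').*2
  | TB1 :: s' => (bits_val s').*2.+1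
  | _ => 0
  end.

Lemma bits_valK m r : bits_val (nat_bits m ++ TEnd :: r) = m.
Proof.
rewrite /nat_bits; case E: (N.of_nat m) => [|x] /=; first by lia.
have -> : m = Pos.to_nat x by lia.
elim: x {E} => [x IH|x IH|] //=; rewrite IH; lia.
Qed.

Lemma enc_gt0 g : 0 < size (enc_f g).
Proof. by case: g. Qed.

Lemma bits_count (pr : pred tok) s :
  all bit_tok s -> pr TB0 = false -> pr TB1 = false -> count pr s = 0.
Proof.
move=> b h0 h1; elim: s b => //= t s IH /andP [tb /IH ->].
by case/orP: tb => /eqP ->; rewrite ?h0 ?h1.
Qed.

(** In Polish notation a conjunction adds one pending operand, a leaf settles one, and a diamond
    changes nothing. *)
Lemma enc_total g :
  count down_tok (enc_f g) = (count (pred1 TAnd) (enc_f g)).+1.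
Proof.
elim: g => [m||a IHa b IHb|a IHa] //=.
  by rewrite !count_cat !(bits_count (nat_bits_bit m)).
by rewrite !count_cat IHa IHb add0n addSn addnS add1n.
Qed.

Lemma enc_prefix g z : z < size (enc_f g) ->
  count down_tok (take z (enc_f g)) <= count (pred1 TAnd) (take z (enc_f g)).
Proof.
elim: g z => [m||a IHa b IHb|a IHa] [|z] //=; rewrite ?size_cat ?ltnS.
- rewrite addn1 ltnS => h; rewrite takel_cat //.
  have ab : all bit_tok (take z (nat_bits m)).
    by apply/allP => t /mem_take; apply/allP/nat_bits_bit.
  by rewrite !(bits_count ab).
- move=> h; rewrite take_cat; case: ltnP => [/IHa h1|le]; first by rewrite add0n add1n leqW.
  rewrite !count_cat enc_total add0n add1n addSn ltnS leq_add2l.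
  by apply: IHb; lia.
- by move=> /IHa; rewrite !add0n.
Qed.

Lemma enc_last g : down_tok (last TTop (enc_f g)).
Proof.
elim: g => [m||a IHa b IHb|a IHa] //=; rewrite ?last_cat //.
  by have := enc_gt0 b; case: (enc_f b) IHb.
by have := enc_gt0 a; case: (enc_f a) IHa.
Qed.

(* Reading the encoding of a formula, the number of leaves first exceeds the
   number of conjunctions at its last token. *)
Lemma enc_end g z : z < size (enc_f g) ->
  (down_tok (nth TTop (enc_f g) z) &&
   (count down_tok (take z (enc_f g)) == count (pred1 TAnd) (take z (enc_f g)))) =
  (z == (size (enc_f g)).-1).
Proof.
move=> h; have e pr : count pr (take z.+1 (enc_f g)) =
    count pr (take z (enc_f g)) + pr (nth TTop (enc_f g) z).
  by rewrite (take_nth TTop) // -cats1 count_cat /= addn0.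
have hA : down_tok (nth TTop (enc_f g) z) -> pred1 TAnd (nth TTop (enc_f g) z) = false.
  by case/orP => /= /eqP ->.
apply/andP/eqP => [[dz /eqP cz]|ez].
  have := e down_tok; have := e (pred1 TAnd); rewrite (hA dz) dz => e1 e2.
  apply/eqP; rewrite eqn_leq; apply/andP; split; first by lia.
  rewrite leqNgt; apply/negP => lt; have lt' : z.+1 < size (enc_f g) by lia.
  by have := enc_prefix lt'; rewrite e2 e1 cz addn0 addn1 ltnn.
have dz : down_tok (nth TTop (enc_f g) z) by rewrite ez nth_last enc_last.
split=> //; have := e down_tok; have := e (pred1 TAnd); rewrite (hA dz) dz.
have -> : z.+1 = size (enc_f g) by lia.
by rewrite take_size enc_total addn0 addn1 => -> [->].
Qed.

(** * Scopes, letters and branches of formula occurrences *)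

Section Structure.
Variable w : seq tok.
Notation n := (size w).
Notation pos := (iota 0 (size w)).
Notation tk := (tk w).
Notation node_at := (node_at w).
Notation scope := (scope w).
Notation inner := (inner w).

Lemma filter_range (P : pred nat) lo len : lo + len <= n ->
  (forall x, P x -> lo <= x < lo + len) -> filter P pos = filter P (iota lo len).
Proof.
move=> le hP; have -> : n = lo + (len + (n - lo - len)) by lia.
rewrite !iotaD !filter_cat add0n.
have none a b : (forall x, a <= x < a + b -> ~~ (lo <= x < lo + len)) ->
    filter P (iota a b) = [::].
  move=> h; apply/eqP; rewrite -(negbK (_ == _)) -has_filter; apply/hasPn => x.
  by rewrite mem_iota => /h; apply: contra; exact: hP.
by rewrite (none 0 lo) ?(none (lo + len)) ?cats0 // => x; lia.
Qed.

Lemma count_range (pr : pred tok) x z : z <= n ->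
  count (fun u => [&& x <= u, u < z & pr (nth TTop w u)]) pos =
  count pr (take (z - x) (drop x w)).
Proof.
move=> zn; case: (leqP x z) => [xz|zx]; last first.
  have -> : z - x = 0 by lia.
  rewrite take0 /=; apply/eqP; rewrite -leqn0 leqNgt -has_count; apply/hasPn => u _.
  by apply/negP => /and3P []; lia.
rewrite -size_filter (@filter_range _ x (z - x)); first last.
- by move=> u /and3P [] *; lia.
- by lia.
rewrite size_filter -(@map_nth_iota _ TTop); last by lia.
rewrite count_map; apply: eq_in_count => u; rewrite mem_iota => h /=.
by have [-> ->] : x <= u /\ u < z by lia.
Qed.

Lemma count_interval x z : z <= n -> count (fun u => x <= u < z) pos = z - x.
Proof.
move=> zn; have := count_range predT x zn; rewrite count_predT size_takel ?size_drop; last by lia.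
by move=> <-; apply: eq_count => u /=; rewrite andbT.
Qed.

(** This treats a diamond with operand [g] and the initial [TImp] followed by the antecedent [g]
    alike. *)
Definition node_of (x : nat) (g : spf) : Prop :=
  node_at x /\ exists r, drop x.+1 w = enc_f g ++ r.

Lemma drop_lt o g r : drop o w = enc_f g ++ r -> o + size (enc_f g) <= n.
Proof.
move=> e; have := congr1 size e; rewrite size_drop size_cat.
by have := enc_gt0 g; lia.
Qed.

Lemma scope_le x y : scope x y -> x <= y < n.
Proof. by case/andP. Qed.

Lemma scope_refl x : x < n -> scope x x.
Proof.
move=> xn; rewrite /scope leqnn xn; apply/hasPn => z _; apply/negP => /and3P [].
by rewrite leqNgt => /negP.
Qed.

(** The token at [x] is neither a leaf nor a conjunction, so the counts from [x] on are those of
    prefixes of [enc_f g], and [enc_end] identifies the end. *)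
Lemma scope_node x g y : node_of x g ->
  scope x y = (x <= y <= x + size (enc_f g)).
Proof.
case=> nx [r e]; have le := drop_lt e; have g0 := enc_gt0 g.
have xn : x < n by lia.
have tx : down_tok (nth TTop w x) = false /\ (nth TTop w x == TAnd) = false.
  by case/orP: nx => /andP [_ /eqP ->].
rewrite /scope.
have E z : x <= z <= x + size (enc_f g) -> [&& down_at w z &
    count (fun u => [&& x <= u, u < z & down_at w u]) pos ==
    count (fun u => [&& x <= u, u < z & tk u TAnd]) pos] = (z == x + size (enc_f g)).
  move=> hz; have zn : z < n by lia.
  have eD u : u < n -> down_at w u = down_tok (nth TTop w u).
    by move=> un; rewrite /down_at /tk un.
  rewrite (eq_in_count (a2 := fun u => [&& x <= u, u < z & down_tok (nth TTop w u)])); last first.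
    by move=> u; rewrite mem_iota => h; rewrite eD.
  rewrite (eq_in_count (a1 := fun u => [&& x <= u, u < z & tk u TAnd])
     (a2 := fun u => [&& x <= u, u < z & pred1 TAnd (nth TTop w u)])); last first.
    by move=> u; rewrite mem_iota /tk => /andP [_ ->].
  rewrite !count_range ?eD ?(ltnW zn) // (drop_nth TTop) // e.
  case: (ltnP x z) => [xz|zx]; last first.
    have -> : z = x by lia.
    by rewrite tx.1 /=; lia.
  have -> : z - x = (z - x.+1).+1 by lia.
  rewrite /= tx.1 tx.2 !add0n.
  have ez : nth TTop w z = nth TTop (enc_f g) (z - x.+1).
    have -> : z = x.+1 + (z - x.+1) by lia.
    by rewrite -nth_drop e nth_cat addKn; have -> : z - x.+1 < size (enc_f g) by lia.
  rewrite ez takel_cat; last by lia.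
  by rewrite enc_end; lia.
case: (leqP x y) => //= xy; case: (ltnP y n) => /= yn; last by lia.
case: leqP => h; last first.
  apply/negbTE; rewrite negbK; apply/hasP; exists (x + size (enc_f g)).
    by rewrite mem_iota; lia.
  by rewrite leq_addr h /= E; lia.
apply/hasPn => z _; apply/negP => /and3P [xz zy]; rewrite E; lia.
Qed.

Lemma tk_drop x t r a : drop x w = t :: r -> tk x a = (t == a).
Proof.
move=> e; have xn : x < n by have := congr1 size e; rewrite size_drop /=; lia.
by rewrite /tk xn -[x]addn0 -nth_drop e.
Qed.

Lemma tk_drop_nth o s r x a : drop o w = s ++ r -> o <= x < o + size s ->
  tk x a = (nth TTop s (x - o) == a).
Proof.
move=> e h; have xn : x < n by have := congr1 size e; rewrite size_drop size_cat; lia.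
rewrite /tk xn -{1}(@subnKC o x); last by lia.
by rewrite -nth_drop e nth_cat; have -> : x - o < size s by lia.
Qed.

Lemma drop_cat_shift o s r : drop o w = s ++ r -> drop (o + size s) w = r.
Proof. by move=> e; rewrite addnC -drop_drop e drop_size_cat. Qed.

Lemma drop_cons_shift o t r : drop o w = t :: r -> drop o.+1 w = r.
Proof. by move=> e; rewrite -add1n -drop_drop e /= drop0. Qed.

Lemma var_block_tok m z : 0 < z < size (enc_f (Var m)) ->
  bit_tok (nth TTop (enc_f (Var m)) z) \/ nth TTop (enc_f (Var m)) z = TEnd.
Proof.
case: z => // z /=; rewrite ltnS size_cat addn1 ltnS nth_cat => h.
case: ltnP => lt; first by left; apply: (allP (nat_bits_bit m)); exact: mem_nth.
by right; have -> : z - size (nat_bits m) = 0 by lia.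
Qed.

(** The strict inequality says that the scope of a node inside an occurrence also ends inside it;
    this separates the scopes of the two conjuncts of a conjunction. *)
Lemma occ_node g o r x : drop o w = enc_f g ++ r -> o <= x < o + size (enc_f g) ->
  node_at x -> exists2 a, node_of x a & x + size (enc_f a) < o + size (enc_f g).
Proof.
elim: g o r => [m||a IHa b IHb|a IHa] o r e h nx.
- exfalso; case: (eqVneq x o) nx => [->|ne].
    by rewrite /node_at !(tk_drop _ e).
  rewrite /node_at !(tk_drop_nth _ e h).
  have : 0 < x - o < size (enc_f (Var m)) by lia.
  by case/var_block_tok => [/orP [] /eqP ->|->].
- have ex : x = o by move: h => /=; lia.
  by move: nx; rewrite ex /node_at !(tk_drop _ e).
- have e1 : drop o.+1 w = enc_f a ++ (enc_f b ++ r).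
    by rewrite catA; exact: drop_cons_shift e.
  have e2 := drop_cat_shift e1.
  case: (eqVneq x o) nx => [->|ne nx]; first by rewrite /node_at !(tk_drop _ e).
  move: h => /=; rewrite size_cat => h.
  case: (ltnP x (o.+1 + size (enc_f a))) => hx.
    by have [|c nc lc] := IHa _ _ e1 _ nx; [lia | exists c => //; lia].
  by have [|c nc lc] := IHb _ _ e2 _ nx; [lia | exists c => //; lia].
- have e1 := drop_cons_shift e.
  case: (eqVneq x o) => [ex|ne].
    exists a; last by rewrite ex /=; lia.
    by split=> //; exists r; rewrite ex.
  by move: h => /= h; have [|c nc lc] := IHa _ _ e1 _ nx; [lia | exists c => //; lia].
Qed.

Lemma occ_var g o r x : drop o w = enc_f g ++ r -> o <= x < o + size (enc_f g) ->
  tk x TVar -> exists m r', drop x w = enc_f (Var m) ++ r'.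
Proof.
elim: g o r => [m||a IHa b IHb|a IHa] o r e h nx.
- case: (eqVneq x o) nx => [->|ne]; first by exists m, r.
  rewrite !(tk_drop_nth _ e h).
  have : 0 < x - o < size (enc_f (Var m)) by lia.
  by case/var_block_tok => [/orP [] /eqP ->|->].
- have ex : x = o by move: h => /=; lia.
  by move: nx; rewrite ex !(tk_drop _ e).
- have e1 : drop o.+1 w = enc_f a ++ (enc_f b ++ r).
    by rewrite catA; exact: drop_cons_shift e.
  have e2 := drop_cat_shift e1.
  case: (eqVneq x o) nx => [->|ne nx]; first by rewrite !(tk_drop _ e).
  move: h => /=; rewrite size_cat => h.
  case: (ltnP x (o.+1 + size (enc_f a))) => hx.
    by apply: IHa e1 _ nx; lia.
  by apply: IHb e2 _ nx; lia.
- have e1 := drop_cons_shift e.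
  case: (eqVneq x o) nx => [->|ne nx]; first by rewrite !(tk_drop _ e).
  by move: h => /= h; apply: IHa e1 _ nx; lia.
Qed.

Definition name (v : nat) : nat := bits_val (drop v.+1 w).

Lemma name_var v m r : drop v w = enc_f (Var m) ++ r -> name v = m.
Proof.
move=> e; have e' : drop v w = TVar :: ((nat_bits m ++ [:: TEnd]) ++ r) := e.
by rewrite /name (drop_cons_shift e') -catA; exact: bits_valK.
Qed.

(** In a conjunction, nodes of one conjunct never scope over the other: those on the left end too
    early by [occ_node], those on the right begin too late by [scope_le]. *)
Lemma occ_vars g o r : drop o w = enc_f g ++ r ->
  [seq name v | v <- iota o (size (enc_f g)) &
    tk v TVar && ~~ has (fun z => node_at z && scope z v) (iota o (size (enc_f g)))]
  = vars g.
Proof.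
elim: g o r => [m||a IHa b IHb|a IHa] o r e.
- have nn v : has (fun z => node_at z && scope z v) (iota o (size (enc_f (Var m)))) = false.
    apply/negbTE/hasPn => z; rewrite mem_iota => hz; apply/negP => /andP [nz _].
    case: (eqVneq z o) nz => [->|ne]; first by rewrite /node_at !(tk_drop _ e).
    rewrite /node_at !(tk_drop_nth _ e hz).
    have : 0 < z - o < size (enc_f (Var m)) by lia.
    by case/var_block_tok => [/orP [] /eqP ->|->].
  rewrite (eq_in_filter (a2 := pred1 o)); last first.
    move=> v; rewrite mem_iota => hv; rewrite nn andbT /=.
    case: (eqVneq v o) => [->|ne]; first by rewrite (tk_drop _ e).
    rewrite (tk_drop_nth _ e hv).
    have : 0 < v - o < size (enc_f (Var m)) by lia.
    by case/var_block_tok => [/orP [] /eqP ->|->].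
  rewrite [filter _ _]/= eqxx.
  rewrite (eq_in_filter (a2 := pred0)) ?filter_pred0; last first.
    by move=> v; rewrite mem_iota /= => hv; apply/negbTE; lia.
  by rewrite /= (name_var e).
- by rewrite /= (tk_drop _ e).
- have e1 : drop o.+1 w = enc_f a ++ (enc_f b ++ r).
    by rewrite catA; exact: drop_cons_shift e.
  have e2 := drop_cat_shift e1.
  have no : node_at o = false by rewrite /node_at !(tk_drop _ e).
  rewrite [enc_f _]/= [size _]/= size_cat [iota _ _]/= iotaD.
  rewrite [filter _ _]/= {1}(tk_drop _ e) /= filter_cat map_cat.
  congr (_ ++ _).
    rewrite -(IHa _ _ e1); congr map; apply: eq_in_filter => v; rewrite mem_iota => hv.
    congr (_ && ~~ _); rewrite no has_cat /=.
    case: has => //=; apply/negbTE/hasPn => z; rewrite mem_iota => hz.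
    by apply/negP => /andP [_ /scope_le]; lia.
  rewrite -(IHb _ _ e2); congr map; apply: eq_in_filter => v; rewrite mem_iota => hv.
  congr (_ && ~~ _); rewrite no has_cat /=.
  rewrite [X in X || _ = _](_ : _ = false) //.
  apply/negbTE/hasPn => z; rewrite mem_iota => hz.
  apply/negP => /andP [nz]; have [c nc lc] := occ_node e1 hz nz.
  by rewrite (scope_node _ nc); lia.
- have e1 := drop_cons_shift e.
  have no : node_of o a by split; [rewrite /node_at !(tk_drop _ e) | exists r].
  rewrite (eq_in_filter (a2 := pred0)) ?filter_pred0 // => v; rewrite mem_iota => hv.
  rewrite /= (scope_node _ no) no.1 /=.
  have -> : o <= v <= o + size (enc_f a) by move: hv => /=; lia.
  by rewrite andbF.
Qed.

Definition vars_at (x : nat) : seq nat :=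
  [seq name v | v <- pos & tk v TVar && inner x v].

Lemma vars_at_node x g : node_of x g -> vars_at x = vars g.
Proof.
move=> nx; have [nax [r e]] := nx; have le := drop_lt e.
rewrite -(occ_vars e) /vars_at (@filter_range _ x.+1 (size (enc_f g))) //; last first.
  move=> v /andP [tv /andP []]; rewrite (scope_node _ nx) => h _.
  suff : v != x by lia.
  apply/eqP => ev; move: nax tv; rewrite ev /node_at /tk.
  by case/orP => /andP [_ /eqP ->]; rewrite andbF.
congr map; apply: eq_in_filter => v; rewrite mem_iota => hv; congr andb.
rewrite /inner (scope_node _ nx).
have -> /= : x <= v <= x + size (enc_f g) by lia.
congr (~~ _); apply/hasP/hasP => -[z].
  move=> _ /and3P [xz nz sz]; exists z; last by rewrite nz.
  by rewrite mem_iota; have := scope_le sz; lia.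
rewrite mem_iota => hz /andP [nz sz]; exists z; last by rewrite nz sz; have -> : x < z by lia.
by rewrite mem_iota; have := scope_le sz; lia.
Qed.

(** A branch is indexed by its last diamond [t]; the nodes having [t] in their scope, listed by
    position, spell it from the outside in. *)
Definition path_in (s : seq nat) (t : nat) : seq (seq nat) :=
  [seq vars_at x | x <- s & node_at x && scope x t].

(** Each node ends one branch, and [paths] lists the branches in the order of these nodes in the
    encoding, so even the sequences agree. *)
Lemma occ_paths g o r : drop o w = enc_f g ++ r ->
  [seq path_in (iota o (size (enc_f g))) t | t <- iota o (size (enc_f g)) & node_at t]
  = paths g.
Proof.
elim: g o r => [m||a IHa b IHb|a IHa] o r e.
- rewrite (eq_in_filter (a2 := pred0)) ?filter_pred0 // => z; rewrite mem_iota => hz.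
  apply/negbTE; case: (eqVneq z o) => [->|ne]; first by rewrite /node_at !(tk_drop _ e).
  rewrite /node_at !(tk_drop_nth _ e hz).
  have : 0 < z - o < size (enc_f (Var m)) by lia.
  by case/var_block_tok => [/orP [] /eqP ->|->].
- by rewrite /= /node_at !(tk_drop _ e).
- have e1 : drop o.+1 w = enc_f a ++ (enc_f b ++ r).
    by rewrite catA; exact: drop_cons_shift e.
  have e2 := drop_cat_shift e1.
  have no : node_at o = false by rewrite /node_at !(tk_drop _ e).
  rewrite [enc_f _]/= [size _]/= size_cat [iota _ _]/= iotaD.
  rewrite [filter _ _]/= no filter_cat map_cat [paths _]/=.
  congr (_ ++ _).
    rewrite -(IHa _ _ e1); apply/eq_in_map => t; rewrite mem_filter mem_iota => /andP [_ ht].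
    rewrite /path_in /= no /= filter_cat map_cat.
    rewrite [X in _ ++ map _ X](_ : _ = [::]) ?cats0 //.
    apply/eqP; rewrite -(negbK (_ == _)) -has_filter; apply/hasPn => x; rewrite mem_iota => hx.
    by apply/negP => /andP [_ /scope_le]; lia.
  rewrite -(IHb _ _ e2); apply/eq_in_map => t; rewrite mem_filter mem_iota => /andP [_ ht].
  rewrite /path_in /= no /= filter_cat map_cat.
  rewrite [X in map _ X ++ _](_ : _ = [::]) //.
  apply/eqP; rewrite -(negbK (_ == _)) -has_filter; apply/hasPn => x; rewrite mem_iota => hx.
  apply/negP => /andP [nx]; have [c nc lc] := occ_node e1 hx nx.
  by rewrite (scope_node _ nc); lia.
- have e1 := drop_cons_shift e.
  have no : node_of o a by split; [rewrite /node_at !(tk_drop _ e) | exists r].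
  rewrite [size _]/= [iota _ _]/= [filter _ _]/= no.1 [map _ _]/= [paths _]/=; congr (_ :: _).
    rewrite /path_in /= no.1 (scope_node _ no) leqnn leq_addr /= (vars_at_node no); congr (_ :: _).
    rewrite (eq_in_filter (a2 := pred0)) ?filter_pred0 // => x; rewrite mem_iota => hx.
    by apply/negbTE/negP => /andP [_ /scope_le]; lia.
  rewrite -(IHa _ _ e1) -map_comp; apply/eq_in_map => t.
  rewrite mem_filter mem_iota => /andP [_ ht].
  rewrite /path_in /= no.1 (scope_node _ no).
  have -> /= : o <= t <= o + size (enc_f a) by lia.
  by rewrite (vars_at_node no).
Qed.

End Structure.

Lemma var_block_end m j : j < size (enc_f (Var m)) ->
  (nth TTop (enc_f (Var m)) j == TEnd) = (j == (size (enc_f (Var m))).-1).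
Proof.
case: j => [|j] /=; rewrite ?size_cat addn1 // ltnS nth_cat ltnS eqSS => h.
case: ltnP => lt; last first.
  have -> : j = size (nat_bits m) by lia.
  by rewrite subnn !eqxx.
have /(allP (nat_bits_bit m)) : nth TTop (nat_bits m) j \in nat_bits m by exact: mem_nth.
by case/orP => /eqP -> /=; apply/esym/negbTE; lia.
Qed.

(** * Correctness of name comparison and of the greedy pointer *)

Section Decision.
Variable w : seq tok.
Notation n := (size w).
Notation pos := (iota 0 (size w)).
Notation tk := (tk w).
Notation node_at := (node_at w).
Notation scope := (scope w).
Notation name := (name w).
Notation vars_at := (vars_at w).

Lemma same_nameP v v' : reflect
  (forall u, v <= u < n -> (forall t, v <= t < u -> ~~ tk t TEnd) ->
    exists2 u', v' <= u' < n & nth TTop w u = nth TTop w u' /\ u - v = u' - v')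
  (same_name w v v').
Proof.
apply: (iffP hasPn) => [h u hu he|h u].
  have := h u; rewrite mem_iota => /(_ ltac:(lia)).
  have -> : v <= u by lia.
  rewrite (_ : has _ pos = false) /=; last first.
    by apply/negbTE/hasPn => t _; apply/negP => /and3P [a b]; apply/negP; apply: he; lia.
  rewrite negbK => /hasP [u']; rewrite mem_iota => un /and3P [le /eqP e1 /eqP].
  have [un1 un2] : u <= n /\ u' <= n by lia.
  by rewrite !count_interval // => e2; exists u' => //; lia.
rewrite mem_iota => hu; apply/negP => /and3P [vu /hasPn he /hasPn no].
have [||u' hu' [e1 e2]] := h u; first by lia.
  move=> t ht; have := he t; rewrite mem_iota => /(_ ltac:(lia)).
  by have [-> ->] : v <= t /\ t < u by lia.
have [un1 un2] : u <= n /\ u' <= n by lia.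
have := no u'; rewrite mem_iota => /(_ ltac:(lia)); rewrite e1 eqxx !count_interval //.
by rewrite e2 eqxx; have -> : v' <= u' by lia.
Qed.

Lemma same_name_var v v' m m' r r' :
  drop v w = enc_f (Var m) ++ r -> drop v' w = enc_f (Var m') ++ r' ->
  same_name w v v' = (m == m').
Proof.
move=> e e'; set L := size (enc_f (Var m)).
have le := drop_lt e; have le' := drop_lt e'; rewrite -/L in le.
have L0 : 0 < L by exact: enc_gt0.
have tkE k : k < L -> nth TTop w (v + k) = nth TTop (enc_f (Var m)) k.
  by move=> kL; rewrite -nth_drop e nth_cat kL.
apply/same_nameP/eqP => [h|em].
  have nthE k : k < L -> v' + k < n /\ nth TTop w (v' + k) = nth TTop (enc_f (Var m)) k.
    move=> kL; have [||u' hu' [e1 e2]] := h (v + k); first by lia.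
      move=> t ht; rewrite (tk_drop_nth _ e); last by rewrite -/L; lia.
      by rewrite var_block_end -/L; lia.
    have -> : v' + k = u' by lia.
    by split; [lia | rewrite -e1 tkE].
  (* The whole block of [m], with its [TEnd], is found again at [v']; as [name] decodes what is
     written there, the two indices agree. *)
  have e2 : drop v' w = enc_f (Var m) ++ drop L (drop v' w).
    rewrite -{1}[drop v' w](cat_take_drop L); congr (_ ++ _).
    have szL : size (take L (drop v' w)) = L.
      by rewrite size_takel // size_drop; have [] := nthE L.-1; lia.
    apply: (@eq_from_nth _ TTop); rewrite ?szL // => k kL.
    by rewrite nth_take // nth_drop; have [_ ->] := nthE k kL.
  by rewrite -(name_var e2) (name_var e').
move=> u hu he; have uL : u - v < L.
  rewrite ltnNge; apply/negP => lt; have := he (v + L.-1).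
  rewrite (tk_drop_nth _ e); last by rewrite -/L; lia.
  rewrite var_block_end -/L; last by lia.
  by rewrite addKn eqxx => /(_ ltac:(lia)).
subst m'; exists (v' + (u - v)); first by rewrite -/L in le'; lia.
split; last by lia.
rewrite -[X in _ = nth _ _ X]addn0 -(@subnKC v u) ?tkE //; last by lia.
by rewrite -addnA addn0 addKn -nth_drop e' nth_cat; rewrite -/L uL.
Qed.

Hypothesis varsw : forall v, tk v TVar -> exists m r, drop v w = enc_f (Var m) ++ r.

Lemma has_varE x v : tk v TVar -> has_var w x v = (name v \in vars_at x).
Proof.
move=> tv; have [m [r e]] := varsw tv.
apply/hasP/mapP => [[v' vin /and3P [tv' iv' sv']]|[v' ]].
  exists v'; first by rewrite mem_filter tv' iv'.
  have [m' [r' e']] := varsw tv'; rewrite (name_var e) (name_var e').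
  by apply/eqP; rewrite -(same_name_var e e').
rewrite mem_filter => /andP [/andP [tv' iv'] vin] en; exists v' => //; rewrite tv' iv' /=.
have [m' [r' e']] := varsw tv'; rewrite (same_name_var e e').
by rewrite -(name_var e) -(name_var e') en.
Qed.

Lemma sub_atE x x' : sub_at w x x' = sub_vars (vars_at x) (vars_at x').
Proof.
apply/hasPn/allP => [h y /mapP [v]|h v vin].
  rewrite mem_filter => /andP [/andP [tv iv] vin] -> /=.
  by have := h v vin; rewrite tv iv negbK has_varE.
apply/negP => /and3P [tv iv]; rewrite has_varE // => /negP; apply.
by apply: h; apply: map_f; rewrite mem_filter tv iv.
Qed.

Section Greedy.
Variable e : nat.
Hypotheses (ne : node_at e) (se : scope e e).

(** The part of the branch still available to a pointer at [b]. Below, [adv] is one round of the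
    inner loop, which stands still exactly at a [good] position or at the end of the input. *)
Let rest b := path_in w (iota b (n - b)) e.

Let good x a := [&& node_at a, scope a e & sub_at w x a].

Let adv x a := if ~~ good x a then minn a.+1 n else a.

Lemma rest_cons b : b < n ->
  rest b = if node_at b && scope b e then vars_at b :: rest b.+1 else rest b.+1.
Proof.
move=> bn; rewrite /rest /path_in -[n - b]prednK; last by lia.
rewrite /=; have -> : (n - b).-1 = n - b.+1 by lia.
by case: ifP.
Qed.

Lemma adv_le x a : a <= n -> adv x a <= n.
Proof. by rewrite /adv; case: ifP => //; lia. Qed.

(** The pointer leaves only positions that carry no letter of the branch or a letter that [skip_to]
    would drop as well. *)
Lemma skip_adv x a : a <= n ->
  skip_to (rest (adv x a)) (vars_at x) = skip_to (rest a) (vars_at x).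
Proof.
rewrite /adv => an; case: ifP => // ng.
case: (ltnP a n) => lt; last by have -> : minn a.+1 n = a by lia.
have -> : minn a.+1 n = a.+1 by lia.
rewrite (rest_cons lt); case: ifP => // /andP [na sa].
by rewrite skip_to_cons -sub_atE; move: ng; rewrite /good na sa /= => /negbTE ->.
Qed.

(** After [k] rounds the pointer rests on a match or has moved [k] places, up to the end; hence [n]
    rounds complete a search. *)
Lemma iter_adv x k a : a <= n -> [/\ iter k (adv x) a <= n,
  skip_to (rest (iter k (adv x) a)) (vars_at x) = skip_to (rest a) (vars_at x) &
  good x (iter k (adv x) a) || (minn (a + k) n <= iter k (adv x) a)].
Proof.
move=> an; elim: k => [|k [h1 h2 h3]]; first by rewrite addn0; split=> //=; lia.
rewrite iterS; split; first exact: adv_le.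
  by rewrite skip_adv.
rewrite {1 3}/adv; case: (boolP (good x (iter k (adv x) a))) => g /=.
  by rewrite g.
by move: h3; rewrite (negbTE g) /= => h3; apply/orP; right; lia.
Qed.

Lemma rest_good x b : b <= n -> good x b || (n <= b) -> skip_to (rest b) (vars_at x) = rest b.
Proof.
move=> bn /orP [|nb].
  move=> /and3P [nb sb]; rewrite sub_atE => sub.
  by rewrite rest_cons ?nb ?sb ?skip_to_cons ?sub //; exact: node_at_lt nb.
have -> : b = n by lia.
by rewrite /rest subnn.
Qed.

Lemma emb_atE t : emb_at w t e = emb (path_in w pos t) (path_in w pos e).
Proof.
have en := node_at_lt ne.
(* The letter at [e] is the last of its branch, so the remaining suffix is nonempty exactly while
   the pointer has not passed [e]. *)
have restE b : b <= n -> (b <= e < n) = (rest b != [::]).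
  move=> bn; rewrite en andbT /rest /path_in.
  have -> (s : seq nat) : ([seq vars_at x | x <- s] != [::]) = (s != [::]) by case: s.
  rewrite -has_filter; apply/idP/hasP => [le|[x]].
    by exists e; rewrite ?ne ?se // mem_iota; lia.
  by rewrite mem_iota => h /andP [_ /scope_le]; lia.
rewrite /emb_at /emb.
set f := fun a x => foldl _ _ _.
have fE a x : f a x = if node_at x && scope x t then iter n (adv x) a else a.
  rewrite /f; case: (node_at x) => /=; last by elim: pos a.
  case: (scope x t) => /=; last by elim: pos a.
  rewrite -[X in iter X](size_iota 0 n).
  by elim: pos a => // y s IH a; rewrite [size _]/= iterSr -IH.
have gen s a : a <= n -> foldl f a s <= n /\
    rest (foldl f a s) = foldl skip_to (rest a) (path_in w s t).
  elim: s a => //= x s IH a an; rewrite fE /path_in /=; case: ifP => h; last exact: IH.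
  have [h1 h2 h3] := iter_adv x n an.
  have [l1 l2] := IH _ h1; split=> //; rewrite l2 /=; congr foldl.
  rewrite -h2 rest_good //; case/orP: h3 => [-> //|h3].
  by apply/orP; right; lia.
have [l1 l2] := gen pos 0 (leq0n n).
by rewrite restE // l2 /rest subn0.
Qed.

End Greedy.

End Decision.

Lemma lin_at_enc i : lin_at (enc i) 0 = lin_dec i.
Proof.
case: i => s t; set w := enc _.
have hw : input_word w := input_word_enc _.
have nE : size w = (size (enc_f s) + size (enc_f t)).+1 by rewrite /w /= size_cat.
have e0 : drop 1 w = enc_f s ++ enc_f t by rewrite /w /= drop0.
clearbody w; set n := size w in nE *.
(* Layout of the input: [TImp] at 0, the antecedent at 1 up to [ls], the consequent from [ls.+1]
   on. *)
set ls := size (enc_f s) in nE *; set lt := size (enc_f t) in nE *.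
have e1 : drop ls.+1 w = enc_f t ++ [::] by rewrite cats0; exact: (drop_cat_shift e0).
have n0 : node_of w 0 s by split; [rewrite /node_at !tk_imp // orbT | exists (enc_f t)].
have scope0 y : scope w 0 y = (y <= ls) by rewrite (scope_node _ n0) add0n.
have varsw v : tk w v TVar -> exists m r, drop v w = enc_f (Var m) ++ r.
  move=> tv; have vn : v < n by case/andP: tv.
  have v0 : v != 0.
    by apply/eqP => v0; have := tk_imp hw v; move: tv; rewrite v0 /tk => /andP [-> /eqP ->].
  case: (leqP v ls) => h; first by apply: (occ_var e0) tv; lia.
  by apply: (occ_var e1) tv; rewrite -/lt; lia.
(* Nodes of the antecedent, and the root at 0, have scopes that end within the antecedent. *)
have nodes_t x y : node_at w x -> scope w x y -> ls < y -> ls < x.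
  move=> nx sxy ly; rewrite ltnNge; apply/negP => le; case: (posnP x) => [x0|xp].
    by move: sxy; rewrite x0 scope0; lia.
  have [|c nc lc] := occ_node e0 _ nx; first by rewrite -/ls; lia.
  by move: sxy; rewrite (scope_node _ nc) -/ls in lc *; lia.
rewrite /lin_at /lin_dec [ante _]/= [Defs.cons _]/= -/n; congr (_ && _).
  rewrite -(vars_at_node n0) -(occ_vars e1) -/lt -all_predC.
  rewrite /sub_vars all_map.
  apply/allP/allP => [h v|h v vin] /=.
    rewrite mem_filter mem_iota => /andP [/andP [tv nh] hv].
    have := h v; rewrite mem_iota /= tv has_varE // => /(_ ltac:(lia)).
    rewrite (_ : has _ _ = false) /= ?negbK //; apply/negbTE; apply: contra nh.
    move=> /hasP [x _ /andP [nx sx]]; apply/hasP; exists x; last by rewrite nx.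
    have := nodes_t _ _ nx sx; have := scope_le sx; rewrite mem_iota -/n -/lt; lia.
  apply/negP => /and3P [tv nh]; rewrite has_varE // => /negP; apply.
  apply: h; rewrite mem_filter tv mem_iota /=; apply/andP; split.
    apply: contra nh => /hasP [x]; rewrite mem_iota => hx hh; apply/hasP; exists x => //.
    by rewrite mem_iota; lia.
  have : ~~ (v <= ls).
    apply: contra nh => le; apply/hasP; exists 0; rewrite ?mem_iota; first by lia.
    by rewrite n0.1 scope0.
  by have : v < n; [case/andP: tv | lia].
(* The root at position 0 contributes the common first letter of the branches of [Dia s]. *)
have path_s e : e <= ls -> path_in w (iota 0 n) e =
    vars s :: path_in w (iota 1 ls) e.
  move=> le; rewrite /path_in (@filter_range _ _ 0 ls.+1); last 2 first.
  - by rewrite -/n; lia.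
  - by move=> x /andP [_ /scope_le]; lia.
  by rewrite /= n0.1 scope0 le /= (vars_at_node n0).
have pathS : [seq path_in w (iota 0 n) e | e <- iota 0 n & node_at w e && scope w 0 e] =
    paths (Dia s).
  rewrite (@filter_range _ _ 0 ls.+1); last 2 first.
  - by rewrite -/n; lia.
  - by move=> x /andP [_]; rewrite scope0; lia.
  rewrite /= n0.1 scope0 /= path_s //; congr (_ :: _).
    rewrite /path_in (eq_in_filter (a2 := pred0)) ?filter_pred0 // => x; rewrite mem_iota => hx.
    by apply/negbTE/negP => /andP [_ /scope_le]; lia.
  rewrite -(occ_paths e0) -/ls -map_comp (eq_in_filter (a2 := node_at w)).
    by apply/eq_in_map => x; rewrite mem_filter mem_iota => /andP [_ hx]; rewrite path_s //; lia.
  by move=> x; rewrite mem_iota scope0 => hx; rewrite (_ : x <= ls) ?andbT //; lia.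
have pathT : [seq path_in w (iota 0 n) x | x <- iota 0 n & tk w x TDia && ~~ scope w 0 x] =
    paths t.
  rewrite (@filter_range _ _ ls.+1 lt); last 2 first.
  - by rewrite -/n; lia.
  - by move=> x /andP [/andP [xn _]]; rewrite scope0; move: xn; rewrite -/n; lia.
  rewrite -(occ_paths e1) -/lt (eq_in_filter (a2 := node_at w)).
    apply/eq_in_map => y; rewrite mem_filter mem_iota => /andP [_ hy].
    rewrite /path_in (@filter_range _ _ ls.+1 lt) //; first by rewrite -/n; lia.
    move=> x /andP [nx sx]; have := nodes_t _ _ nx sx; have := scope_le sx; lia.
  move=> x; rewrite mem_iota scope0 => hx; rewrite /node_at tk_imp //.
  have -> : (x == 0) = false by lia.
  have lx : ls < x by lia.
  by rewrite orbF -ltnNge lx andbT.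
rewrite -pathT -pathS all_map -all_predC all_filter.
apply: eq_all => x /=; rewrite andbA negb_and negbK implybE; congr orb.
rewrite has_map; apply/hasP/hasP => [[e ein /and3P [ne s0 em]]|[e]].
  exists e; first by rewrite mem_filter ne s0.
  by rewrite /= -emb_atE //; apply/scope_refl/node_at_lt.
rewrite mem_filter => /andP [/andP [ne s0] ein] em; exists e => //; rewrite ne s0 emb_atE //.
exact/scope_refl/node_at_lt.
Qed.

Theorem theorem7p13 : poly_time_decidable SPi_lin.
Proof.
apply: (poly_time_expr ewf_ELin) => i.
by rewrite (evale_lin (input_word_enc i)) lin_at_enc SPi_linP.
Qed.
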